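(* Let $\mathcal{M}$ be a rigid subcategory of $\mathcal{B}$ which contains all projective objects of $\mathcal{B}$. Then the functor $F:\mathcal{M}_L/[\mathcal{M}]\to\operatorname{mod}\underline{\mathcal{M}}$ induced by $X\mapsto\operatorname{Ext}^1_{\mathcal{B}}(-,X)|_{\mathcal{M}}$ is an equivalence of categories.
   Context: $k$ is a field and $\mathcal{B}$ is a $k$-linear, Hom-finite, Krull-Schmidt exact category (in the sense of Quillen) with enough projectives and enough injectives. $\mathcal{P}$ denotes the full subcategory of projective objects. Subcategories are full and closed under isomorphisms and finite direct sums. $\mathcal{M}$ is rigid if $\operatorname{Ext}^1_{\mathcal{B}}(M,M')=0$ for all $M,M'\in\mathcal{M}$. For a subcategory $\mathcal{C}$, $[\mathcal{C}](X,Y)$ is the set of morphisms $X\to Y$ factoring through an object of $\mathcal{C}$, and the quotient of a category by $[\mathcal{C}]$ has the same objects and morphism spaces $\operatorname{Hom}(X,Y)/[\mathcal{C}](X,Y)$. $\underline{\mathcal{M}}=\mathcal{M}/[\mathcal{P}]$ is the stable category of $\mathcal{M}$. For an additive $k$-linear category $\mathcal{D}$, $\operatorname{Mod}\mathcal{D}$ is the category of contravariant additive functors $\mathcal{D}\to\operatorname{mod}k$ (finite-dimensional vector spaces), and $\operatorname{mod}\mathcal{D}$ is its full subcategory of functors $A$ admitting an exact sequence $\operatorname{Hom}_{\mathcal{D}}(-,D_1)\to\operatorname{Hom}_{\mathcal{D}}(-,D_0)\to A\to 0$ with $D_0,D_1\in\mathcal{D}$. $\mathcal{M}_L$ is the full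 subcategory of objects $X\in\mathcal{B}$ admitting a short exact sequence $0\to X\to M^0\to M^1\to 0$ with $M^0,M^1\in\mathcal{M}$. The functor $H:\mathcal{M}_L\to\operatorname{Mod}\underline{\mathcal{M}}$, $HX=\operatorname{Ext}^1_{\mathcal{B}}(-,X)|_{\mathcal{M}}$, vanishes on $\mathcal{M}$, so it factors through the projection $\mathcal{M}_L\to\mathcal{M}_L/[\mathcal{M}]$ as a functor $F$; its values lie in $\operatorname{mod}\underline{\mathcal{M}}$. *)

(* Defs.v *)
From HB Require Import structures.
From mathcomp Require Import all_boot all_algebra ring_quotient generic_quotient.
From mathcomp Require Import boolp.

Set Implicit Arguments.
Unset Strict Implicit.
Unset Printing Implicit Defensive.

Import GRing.Theory.
Local Open Scope ring_scope.
Local Open Scope quotient_scope.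

Reserved Notation "g ∘ f" (at level 40, left associativity).

Definition finite_dim (k : fieldType) (V : lmodType k) : Prop :=
  exists (n : nat) (e : 'I_n -> V),
    forall v, exists c : 'I_n -> k, v = \sum_i c i *: e i.

Lemma finite_dim_surj (k : fieldType) (V W : lmodType k) (f : {linear V -> W}) :
  (forall w, exists v, f v = w) -> finite_dim V -> finite_dim W.
Proof.
move=> fsurj [n [e eP]]; exists n, (fun i => f (e i)) => w.
have [v <-] := fsurj w; have [c ->] := eP v; exists c.
by rewrite linear_sum; apply: eq_bigr => i _; rewrite linearZ.
Qed.

Section LmodQuotient.
Variables (k : fieldType) (V : lmodType k) (S : submodClosed V).

Definition submod_pred : V -> bool := fun v => v \in S.
HB.instance Definition _ := GRing.isZmodClosed.Build V submod_pred
  (GRing.submod_closedB (submodClosedP S)).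
Local Notation Z := (GRing.ZmodClosed.clone V submod_pred _).

(* Library quotient of zmodTypes, extended below by the scalar action.        *)
Definition lmod_quot := Quotient.quot Z.
HB.instance Definition _ := GRing.Zmodule.on lmod_quot.

Definition lmod_quot_pi (v : V) : lmod_quot := \pi_(Quotient.quot Z) v.
Definition lmod_quot_repr (q : lmod_quot) : V := repr (q : Quotient.quot Z).

Lemma lmod_quot_reprK q : lmod_quot_pi (lmod_quot_repr q) = q.
Proof. exact: reprK. Qed.

Lemma lmod_quot_eq v w : lmod_quot_pi v = lmod_quot_pi w <-> v - w \in S.
Proof.
by rewrite -[v - w \in S]/(v - w \in Z) Quotient.idealrBE; split=> [/eqP|/eqP].
Qed.

Lemma lmod_quot_reprB v : lmod_quot_repr (lmod_quot_pi v) - v \in S.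
Proof. by apply/lmod_quot_eq; rewrite lmod_quot_reprK. Qed.

Lemma lmod_quot_piD v w :
  lmod_quot_pi (v + w) = lmod_quot_pi v + lmod_quot_pi w.
Proof. exact: (raddfD \pi_(Quotient.quot Z)). Qed.

Definition lmod_quot_scale (a : k) (q : lmod_quot) : lmod_quot :=
  lmod_quot_pi (a *: lmod_quot_repr q).

Lemma lmod_quot_piZ a v :
  lmod_quot_pi (a *: v) = lmod_quot_scale a (lmod_quot_pi v).
Proof.
apply/lmod_quot_eq; rewrite -scalerBr rpredZ //.
by apply/lmod_quot_eq; rewrite lmod_quot_reprK.
Qed.

Fact lmod_quot_scaleA a b q :
  lmod_quot_scale a (lmod_quot_scale b q) = lmod_quot_scale (a * b) q.
Proof. by rewrite -(lmod_quot_reprK q) -!lmod_quot_piZ scalerA. Qed.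
Fact lmod_quot_scale1 : left_id 1 lmod_quot_scale.
Proof. by move=> q; rewrite -(lmod_quot_reprK q) -!lmod_quot_piZ scale1r. Qed.
Fact lmod_quot_scaleDr : right_distributive lmod_quot_scale +%R.
Proof.
move=> a q r; rewrite -(lmod_quot_reprK q) -(lmod_quot_reprK r).
by rewrite -lmod_quot_piD -!lmod_quot_piZ scalerDr lmod_quot_piD.
Qed.
Fact lmod_quot_scaleDl q : {morph lmod_quot_scale^~ q : a b / a + b}.
Proof.
move=> a b /=; rewrite -(lmod_quot_reprK q).
by rewrite -!lmod_quot_piZ scalerDl lmod_quot_piD.
Qed.
HB.instance Definition _ := GRing.Zmodule_isLmodule.Build k lmod_quot
  lmod_quot_scaleA lmod_quot_scale1 lmod_quot_scaleDr lmod_quot_scaleDl.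

Fact lmod_quot_pi_linear : linear lmod_quot_pi.
Proof. by move=> a v w; rewrite lmod_quot_piD lmod_quot_piZ. Qed.
HB.instance Definition _ := GRing.isLinear.Build k V lmod_quot _ lmod_quot_pi
  lmod_quot_pi_linear.

Lemma lmod_quot_fin : finite_dim V -> finite_dim lmod_quot.
Proof.
apply: (finite_dim_surj (f := lmod_quot_pi)) => q.
by exists (lmod_quot_repr q); rewrite /= lmod_quot_reprK.
Qed.

End LmodQuotient.

Record category := Category {
  obj :> Type;
  arr : obj -> obj -> Type;
  idc : forall x, arr x x;
  cmp : forall x y z, arr y z -> arr x y -> arr x z;
  cmpA : forall x y z t (h : arr z t) (g : arr y z) (f : arr x y),
    cmp h (cmp g f) = cmp (cmp h g) f;
  cmp1l : forall x y (f : arr x y), cmp (idc y) f = f;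
  cmp1r : forall x y (f : arr x y), cmp f (idc x) = f }.
Arguments idc {c} x.
Arguments cmp {c x y z} g f.

Record functor (C D : category) := Functor {
  fob :> C -> D;
  fmap : forall x y, arr x y -> arr (fob x) (fob y);
  fmap1 : forall x, fmap (idc x) = idc (fob x);
  fmapM : forall x y z (g : arr y z) (f : arr x y),
    fmap (cmp g f) = cmp (fmap g) (fmap f) }.
Arguments fmap {C D} f {x y} : rename.

Definition functor_id (C : category) : functor C C :=
  @Functor C C id (fun x y f => f) (fun=> erefl) (fun _ _ _ _ _ => erefl).

Section FunctorComp.
Variables (C D E : category) (G : functor D E) (F : functor C D).

Fact functor_comp1 x : fmap G (fmap F (idc x)) = idc (G (F x)).
Proof. by rewrite !fmap1. Qed.
Fact functor_compM x y z (g : arr y z) (f : arr x y) :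
  fmap G (fmap F (cmp g f)) = cmp (fmap G (fmap F g)) (fmap G (fmap F f)).
Proof. by rewrite !fmapM. Qed.

Definition functor_comp : functor C E :=
  @Functor C E (fun x => G (F x)) (fun x y f => fmap G (fmap F f))
    functor_comp1 functor_compM.
End FunctorComp.

Definition is_iso_arr (C : category) (x y : C) (f : arr x y) : Prop :=
  exists g : arr y x, cmp g f = idc x /\ cmp f g = idc y.

Definition nat_iso (C D : category) (F G : functor C D) : Prop :=
  exists t : forall x, arr (F x) (G x),
    (forall x y (f : arr x y), cmp (t y) (fmap F f) = cmp (fmap G f) (t x)) /\
    (forall x, is_iso_arr (t x)).

Definition equivalence_of_categories (C D : category) (F : functor C D) : Prop :=
  exists G : functor D C,
    nat_iso (functor_comp G F) (functor_id C) /\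
    nat_iso (functor_comp F G) (functor_id D).

Section FullSubcategory.
Variables (C : category) (P : C -> Prop).

Definition full_sub : category :=
  @Category {x : C | P x} (fun x y => arr (sval x) (sval y))
    (fun x => idc (sval x)) (fun x y z g f => cmp g f)
    (fun _ _ _ _ _ _ _ => cmpA _ _ _) (fun _ _ _ => cmp1l _)
    (fun _ _ _ => cmp1r _).
End FullSubcategory.

(* Hom-finite k-linear categories; additivity (existence of finite direct     *)
(* sums) is the separate predicate [additive_cat].                            *)

Record linCat (k : fieldType) := LinCat {
  lobj :> Type;
  hom : lobj -> lobj -> lmodType k;
  idl : forall x, hom x x;
  comp : forall x y z, hom y z -> hom x y -> hom x z;
  compA : forall x y z t (h : hom z t) (g : hom y z) (f : hom x y),
    comp h (comp g f) = comp (comp h g) f;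
  comp1l : forall x y (f : hom x y), comp (idl y) f = f;
  comp1r : forall x y (f : hom x y), comp f (idl x) = f;
  comp_linl : forall x y z (f : hom x y), linear (fun g : hom y z => comp g f);
  comp_linr : forall x y z (g : hom y z), linear (fun f : hom x y => comp g f);
  hom_fin : forall x y, finite_dim (hom x y) }.
Arguments idl {k l} x.
Arguments comp {k l x y z} g f.

Notation "g ∘ f" := (comp g f).

Definition cat_of_linCat (k : fieldType) (D : linCat k) : category :=
  @Category D (fun x y => hom x y) (fun x => idl x) (fun x y z g f => g ∘ f)
    (@compA k D) (@comp1l k D) (@comp1r k D).
Coercion cat_of_linCat : linCat >-> category.

Section LinCatTheory.
Variables (k : fieldType) (D : linCat k).
Implicit Types x y z : D.

Definition compl x y z (f : hom x y) (g : hom y z) := g ∘ f.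
HB.instance Definition _ x y z (f : hom x y) :=
  GRing.isLinear.Build k (hom y z) (hom x z) _ (@compl x y z f)
    (@comp_linl k D x y z f).
HB.instance Definition _ x y z (g : hom y z) :=
  GRing.isLinear.Build k (hom x y) (hom x z) _ (@comp k D x y z g)
    (@comp_linr k D x y z g).

Lemma compDl x y z (g g' : hom y z) (f : hom x y) :
  (g + g') ∘ f = g ∘ f + g' ∘ f.
Proof. exact: (linearD (compl f)). Qed.
Lemma compBl x y z (g g' : hom y z) (f : hom x y) :
  (g - g') ∘ f = g ∘ f - g' ∘ f.
Proof. exact: (linearB (compl f)). Qed.
Lemma compNl x y z (g : hom y z) (f : hom x y) : (- g) ∘ f = - (g ∘ f).
Proof. exact: (linearN (compl f)). Qed.
Lemma compZl x y z a (g : hom y z) (f : hom x y) : (a *: g) ∘ f = a *: (g ∘ f).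
Proof. by rewrite -[LHS]/(compl f _) linearZ. Qed.
Lemma comp0l x y z (f : hom x y) : (0 : hom y z) ∘ f = 0.
Proof. exact: (linear0 (compl f)). Qed.
Lemma compDr x y z (g : hom y z) (f f' : hom x y) :
  g ∘ (f + f') = g ∘ f + g ∘ f'.
Proof. exact: linearD. Qed.
Lemma compBr x y z (g : hom y z) (f f' : hom x y) :
  g ∘ (f - f') = g ∘ f - g ∘ f'.
Proof. exact: linearB. Qed.
Lemma compNr x y z (g : hom y z) (f : hom x y) : g ∘ (- f) = - (g ∘ f).
Proof. exact: linearN. Qed.
Lemma compZr x y z a (g : hom y z) (f : hom x y) : g ∘ (a *: f) = a *: (g ∘ f).
Proof. by rewrite linearZ. Qed.
Lemma comp0r x y z (g : hom y z) : g ∘ (0 : hom x y) = 0.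
Proof. exact: linear0. Qed.
Lemma comp_suml x y z n (g : 'I_n -> hom y z) (f : hom x y) :
  (\sum_i g i) ∘ f = \sum_i g i ∘ f.
Proof. exact: (linear_sum (compl f)). Qed.
Lemma comp_sumr x y z n (g : hom y z) (f : 'I_n -> hom x y) :
  g ∘ (\sum_i f i) = \sum_i g ∘ f i.
Proof. exact: linear_sum. Qed.

Definition is_iso x y (f : hom x y) : Prop :=
  exists g : hom y x, g ∘ f = idl x /\ f ∘ g = idl y.

Definition isomorphic x y : Prop := exists f : hom x y, is_iso f.

(* Direct sums of finite families; for n = 0 this says that s is a zero       *)
(* object.                                                                    *)
Definition is_dsum n (Y : 'I_n -> D) (s : D) : Prop :=
  exists (i : forall j, hom (Y j) s) (p : forall j, hom s (Y j)),
    [/\ forall j, p j ∘ i j = idl (Y j),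
        forall j l, j != l -> p j ∘ i l = 0
      & \sum_j i j ∘ p j = idl s].

Definition additive_cat : Prop :=
  forall n (Y : 'I_n -> D), exists s, is_dsum Y s.

(* Local endomorphism ring: nonzero, and the sum of two non-units is a        *)
(* non-unit (units of End x are the automorphisms).                           *)
Definition local_end x : Prop :=
  idl x <> 0 /\
  forall f g : hom x x, is_iso (f + g) -> is_iso f \/ is_iso g.

Definition krull_schmidt : Prop :=
  forall x, exists n (Y : 'I_n -> D), is_dsum Y x /\ forall j, local_end (Y j).

(* A full subcategory, given by its objects.                                  *)
Record subcat := Subcat {
  in_subcat :> D -> Prop;
  subcat_iso : forall x y, isomorphic x y -> in_subcat x -> in_subcat y;
  subcat_dsum : forall n (Y : 'I_n -> D) s,
    is_dsum Y s -> (forall j, in_subcat (Y j)) -> in_subcat s }.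

Definition factors_through (C : D -> Prop) x y (f : hom x y) : Prop :=
  exists2 z, C z & exists (g : hom z y) (h : hom x z), f = g ∘ h.

Record ideal := Ideal {
  in_ideal :> forall x y, submodClosed (hom x y);
  ideal_compl : forall x y z (g : hom y z) (f : hom x y),
    f \in in_ideal x y -> g ∘ f \in in_ideal x z;
  ideal_compr : forall x y z (g : hom y z) (f : hom x y),
    g \in in_ideal y z -> g ∘ f \in in_ideal x z }.

End LinCatTheory.

Section Quotient.
Variables (k : fieldType) (D : linCat k) (I : ideal D).

Local Notation Q x y := (lmod_quot (I x y)).
Local Notation cl := (@lmod_quot_pi _ _ _).
Local Notation rep := (@lmod_quot_repr _ _ _).

Definition quot_comp x y z (g : Q y z) (f : Q x y) : Q x z :=
  cl (rep g ∘ rep f).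

Lemma quot_compE x y z (g : hom y z) (f : hom x y) :
  quot_comp (cl g) (cl f) = cl (g ∘ f).
Proof.
apply/lmod_quot_eq; set g' := rep _; set f' := rep _.
have -> : g' ∘ f' - g ∘ f = (g' - g) ∘ f' + g ∘ (f' - f).
  by rewrite compBl compBr addrA subrK.
by rewrite rpredD //; [apply: ideal_compr|apply: ideal_compl];
  apply/lmod_quot_eq; rewrite lmod_quot_reprK.
Qed.

Fact quot_compA x y z t (h : Q z t) (g : Q y z) (f : Q x y) :
  quot_comp h (quot_comp g f) = quot_comp (quot_comp h g) f.
Proof.
rewrite -(lmod_quot_reprK h) -(lmod_quot_reprK g) -(lmod_quot_reprK f).
by rewrite !quot_compE compA.
Qed.
Fact quot_comp1l x y (f : Q x y) : quot_comp (cl (idl y)) f = f.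
Proof. by rewrite -(lmod_quot_reprK f) quot_compE comp1l. Qed.
Fact quot_comp1r x y (f : Q x y) : quot_comp f (cl (idl x)) = f.
Proof. by rewrite -(lmod_quot_reprK f) quot_compE comp1r. Qed.
Fact quot_comp_linl x y z (f : Q x y) :
  linear (fun g : Q y z => quot_comp g f).
Proof.
move=> a g g'; rewrite -(lmod_quot_reprK g) -(lmod_quot_reprK g').
rewrite -(lmod_quot_reprK f) -linearP !quot_compE -linearP.
by rewrite compDl compZl.
Qed.
Fact quot_comp_linr x y z (g : Q y z) :
  linear (fun f : Q x y => quot_comp g f).
Proof.
move=> a f f'; rewrite -(lmod_quot_reprK f) -(lmod_quot_reprK f').
rewrite -(lmod_quot_reprK g) -linearP !quot_compE -linearP.
by rewrite compDr compZr.
Qed.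

Definition quot_cat : linCat k :=
  @LinCat k D (fun x y => Q x y) (fun x => cl (idl x))
    quot_comp quot_compA quot_comp1l quot_comp1r
    quot_comp_linl quot_comp_linr
    (fun x y => lmod_quot_fin (I x y) (hom_fin x y)).

Variables (E : category) (F : functor D E).
Hypothesis FI : forall (x y : D) (f g : hom x y),
  f - g \in I x y -> fmap F f = fmap F g.

Definition quot_fmap x y (f : Q x y) : arr (F x) (F y) := fmap F (rep f).

Lemma quot_fmapE x y (f : hom x y) : quot_fmap (cl f) = fmap F f.
Proof. by apply: FI; apply/lmod_quot_eq; rewrite lmod_quot_reprK. Qed.

Fact quot_fmap1 x : quot_fmap (cl (idl x)) = idc (F x).
Proof. by rewrite quot_fmapE; apply: (fmap1 F). Qed.
Fact quot_fmapM x y z (g : Q y z) (f : Q x y) :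
  quot_fmap (quot_comp g f) = cmp (quot_fmap g) (quot_fmap f).
Proof.
rewrite -(lmod_quot_reprK g) -(lmod_quot_reprK f) quot_compE !quot_fmapE.
exact: (fmapM F).
Qed.

Definition quot_functor : functor quot_cat E :=
  @Functor quot_cat E (fun x => F x) quot_fmap quot_fmap1 quot_fmapM.

End Quotient.

Section FullLin.
Variables (k : fieldType) (D : linCat k) (S : D -> Prop).

Definition full_lin : linCat k :=
  @LinCat k {x : D | S x} (fun x y => hom (sval x) (sval y))
    (fun x => idl (sval x)) (fun x y z g f => g ∘ f)
    (fun _ _ _ _ _ _ _ => compA _ _ _) (fun _ _ _ => comp1l _)
    (fun _ _ _ => comp1r _)
    (fun _ _ _ _ => comp_linl _) (fun _ _ _ _ => comp_linr _)
    (fun x y => hom_fin (sval x) (sval y)).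

Variable I : ideal D.

(* For I = [C], the objects of C need not lie in S here; in both uses below   *)
(* they do.                                                                   *)
Definition full_ideal : ideal full_lin :=
  @Ideal k full_lin (fun x y => I (sval x) (sval y))
    (fun _ _ _ _ _ => @ideal_compl _ _ I _ _ _ _ _)
    (fun _ _ _ _ _ => @ideal_compr _ _ I _ _ _ _ _).

End FullLin.

Section FactorIdeal.
Variables (k : fieldType) (D : linCat k) (addD : additive_cat D).
Variable C : subcat D.

Definition factor_pred x y : {pred hom x y} :=
  fun f : hom x y => `[< factors_through C f >].

Lemma subcat_zero : exists z, C z.
Proof.
have Y : 'I_0 -> D by case.
by have [z zP] := addD Y; exists z; apply: (subcat_dsum zP) => -[].
Qed.

Fact factor_closed x y : subsemimod_closed (@factor_pred x y).
Proof.
split; [split|].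
- apply/asboolP; have [z Cz] := subcat_zero; exists z => //.
  by exists 0, 0; rewrite comp0l.
- move=> _ _ /asboolP[z Cz [g [h ->]]] /asboolP[z' Cz' [g' [h' ->]]].
  pose Y (j : 'I_2) := if j == 0 then z else z'.
  have [s sP] := addD Y; apply/asboolP; exists s.
    by apply: (subcat_dsum sP) => j; rewrite /Y; case: ifP.
  have [i [p [pi1 pi0 _]]] := sP.
  exists (g ∘ p 0 + g' ∘ p 1), (i 0 ∘ h + i 1 ∘ h').
  rewrite compDl !compDr -!compA.
  rewrite (compA (p 0) (i 0)) (compA (p 0) (i 1)) pi1 pi0 //.
  rewrite (compA (p 1) (i 0)) (compA (p 1) (i 1)) pi1 pi0 //.
  by rewrite !comp0l !comp0r !comp1l addr0 add0r.
- move=> a _ /asboolP[z Cz [g [h ->]]]; apply/asboolP; exists z => //.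
  by exists (a *: g), h; rewrite compZl.
Qed.

HB.instance Definition _ x y :=
  GRing.isSubSemiModClosed.Build k (hom x y) (@factor_pred x y) (factor_closed x y).

Fact factor_compl x y z (g : hom y z) (f : hom x y) :
  f \in @factor_pred x y -> g ∘ f \in @factor_pred x z.
Proof.
move=> /asboolP[t Ct [b [a ->]]]; apply/asboolP; exists t => //.
by exists (g ∘ b), a; rewrite compA.
Qed.
Fact factor_compr x y z (g : hom y z) (f : hom x y) :
  g \in @factor_pred y z -> g ∘ f \in @factor_pred x z.
Proof.
move=> /asboolP[t Ct [b [a ->]]]; apply/asboolP; exists t => //.
by exists b, (a ∘ f); rewrite compA.
Qed.

Definition factor_ideal : ideal D :=
  @Ideal k D (fun x y => GRing.SubmodClosed.clone k (hom x y) (@factor_pred x y) _)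
    factor_compl factor_compr.

Lemma factor_idealP x y (f : hom x y) :
  f \in factor_ideal x y <-> factors_through C f.
Proof. by split=> /asboolP. Qed.

End FactorIdeal.

Section KernelsPushouts.
Variables (k : fieldType) (D : linCat k).
Implicit Types X Y Z E M T : D.

Definition is_kernel X E M (i : hom X E) (p : hom E M) : Prop :=
  p ∘ i = 0 /\ forall T (t : hom T E), p ∘ t = 0 -> exists! s, i ∘ s = t.

Definition is_cokernel X E M (p : hom E M) (i : hom X E) : Prop :=
  p ∘ i = 0 /\ forall T (t : hom E T), t ∘ i = 0 -> exists! s, s ∘ p = t.

Definition is_pushout X E X' E' (i : hom X E) (f : hom X X')
    (f' : hom E E') (i' : hom X' E') : Prop :=
  f' ∘ i = i' ∘ f /\
  forall T (g : hom E T) (h : hom X' T), g ∘ i = h ∘ f ->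
    exists! u : hom E' T, u ∘ f' = g /\ u ∘ i' = h.

Definition is_pullback E M E' M' (p : hom E M) (f : hom M' M)
    (f' : hom E' E) (p' : hom E' M') : Prop :=
  p ∘ f' = f ∘ p' /\
  forall T (g : hom T E) (h : hom T M'), p ∘ g = f ∘ h ->
    exists! u : hom T E', f' ∘ u = g /\ p' ∘ u = h.

Lemma iso_id X : is_iso (idl X).
Proof. by exists (idl X); rewrite comp1l. Qed.

Lemma kernel_mono X E M (i : hom X E) (p : hom E M) T (s s' : hom T X) :
  is_kernel i p -> i ∘ s = i ∘ s' -> s = s'.
Proof.
move=> [pi0 /(_ T (i ∘ s))[]]; first by rewrite compA pi0 comp0l.
by move=> r [_ r_uniq] e; rewrite -(r_uniq s) // -(r_uniq s') // -e.
Qed.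

Lemma cokernel_epi X E M (p : hom E M) (i : hom X E) T (s s' : hom M T) :
  is_cokernel p i -> s ∘ p = s' ∘ p -> s = s'.
Proof.
move=> [pi0 /(_ T (s ∘ p))[]]; first by rewrite -compA pi0 comp0r.
by move=> r [_ r_uniq] e; rewrite -(r_uniq s) // -(r_uniq s') // -e.
Qed.

End KernelsPushouts.

(* Exact categories in the sense of Quillen: an additive category with a      *)
(* class of kernel-cokernel pairs X -i-> E -p-> M, the short exact sequences, *)
(* subject to the self-dual list of axioms of Keller and Buehler.             *)
Record exactCat (k : fieldType) := ExactCat {
  ex_lin :> linCat k;
  ex_additive : additive_cat ex_lin;
  ses : forall X E M : ex_lin, hom X E -> hom E M -> Prop;
  inflation := fun (X E : ex_lin) (i : hom X E) =>
    exists M (p : hom E M), ses i p;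
  deflation := fun (E M : ex_lin) (p : hom E M) =>
    exists X (i : hom X E), ses i p;
  ses_kernel : forall X E M (i : hom X E) (p : hom E M),
    ses i p -> is_kernel i p;
  ses_cokernel : forall X E M (i : hom X E) (p : hom E M),
    ses i p -> is_cokernel p i;
  ses_iso : forall X E M X' E' M' (i : hom X E) (p : hom E M)
      (i' : hom X' E') (p' : hom E' M')
      (a : hom X X') (b : hom E E') (c : hom M M'),
    is_iso a -> is_iso b -> is_iso c -> b ∘ i = i' ∘ a -> c ∘ p = p' ∘ b ->
    ses i p -> ses i' p';
  inflation_id : forall X, inflation (idl X);
  deflation_id : forall X, deflation (idl X);
  inflation_comp : forall X Y Z (g : hom Y Z) (f : hom X Y),
    inflation f -> inflation g -> inflation (g ∘ f);
  deflation_comp : forall X Y Z (g : hom Y Z) (f : hom X Y),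
    deflation f -> deflation g -> deflation (g ∘ f);
  inflation_pushout : forall X E X' (i : hom X E) (f : hom X X'), inflation i ->
    exists E' (f' : hom E E') (i' : hom X' E'),
      is_pushout i f f' i' /\ inflation i';
  deflation_pullback : forall E M M' (p : hom E M) (f : hom M' M), deflation p ->
    exists E' (f' : hom E' E) (p' : hom E' M'),
      is_pullback p f f' p' /\ deflation p' }.
Arguments ex_additive {k} e n Y : rename.
Arguments ses {k e X E M} i p : rename.
Arguments inflation {k e X E} i : rename.
Arguments deflation {k e E M} p : rename.

Section Biproducts.
Variables (k : fieldType) (D : linCat k).

Record biprod (x y : D) := Biprod {
  bip :> D;
  inj1 : hom x bip; inj2 : hom y bip;
  prj1 : hom bip x; prj2 : hom bip y;
  prj1inj1 : prj1 ∘ inj1 = idl x; prj2inj2 : prj2 ∘ inj2 = idl y;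
  prj1inj2 : prj1 ∘ inj2 = 0; prj2inj1 : prj2 ∘ inj1 = 0;
  biprod_sum : inj1 ∘ prj1 + inj2 ∘ prj2 = idl bip }.

Definition biprod_map x y x' y' (b : biprod x y) (b' : biprod x' y')
    (f : hom x x') (g : hom y y') : hom b b' :=
  inj1 b' ∘ f ∘ prj1 b + inj2 b' ∘ g ∘ prj2 b.

Definition diagonal x (b : biprod x x) : hom x b := inj1 b + inj2 b.
Definition codiagonal x (b : biprod x x) : hom b x := prj1 b + prj2 b.

Lemma biprod_exists : additive_cat D ->
  forall x y, exists b : biprod x y, True.
Proof.
move=> addD x y; have [s [i [p [pi1 pi0 sum1]]]] :=
  addD _ (fun j : 'I_2 => if j == 0 then x else y).
have h : (i 0 : hom x s) ∘ (p 0 : hom s x) + (i 1 : hom y s) ∘ (p 1 : hom s y)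
  = idl s.
  have e : lift ord0 ord0 = 1 :> 'I_2 by apply: val_inj.
  by rewrite -sum1 !big_ord_recl big_ord0 addr0 e.
by exists (@Biprod x y s (i 0) (i 1) (p 0) (p 1)
  (pi1 0) (pi1 1) (pi0 0 1 isT) (pi0 1 0 isT) h).
Qed.

Definition biprod_swap x y (b : biprod x y) : biprod y x :=
  @Biprod y x b (inj2 b) (inj1 b) (prj2 b) (prj1 b) (prj2inj2 b) (prj1inj1 b)
    (prj2inj1 b) (prj1inj2 b)
    (etrans (addrC _ _) (biprod_sum b)).

Section Maps.
Variables (x y x' y' : D) (b : biprod x y) (b' : biprod x' y').
Variables (f : hom x x') (g : hom y y').

Lemma prj1_map : prj1 b' ∘ biprod_map b b' f g = f ∘ prj1 b.
Proof.
by rewrite compDr !compA prj1inj1 prj1inj2 !comp0l comp1l addr0.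
Qed.
Lemma prj2_map : prj2 b' ∘ biprod_map b b' f g = g ∘ prj2 b.
Proof.
by rewrite compDr !compA prj2inj1 prj2inj2 !comp0l comp1l add0r.
Qed.
Lemma map_inj1 : biprod_map b b' f g ∘ inj1 b = inj1 b' ∘ f.
Proof.
by rewrite compDl -!compA prj1inj1 prj2inj1 !comp0r comp1r addr0.
Qed.
Lemma map_inj2 : biprod_map b b' f g ∘ inj2 b = inj2 b' ∘ g.
Proof.
by rewrite compDl -!compA prj1inj2 prj2inj2 !comp0r comp1r add0r.
Qed.
Lemma biprod_map_swap :
  biprod_map (biprod_swap b) (biprod_swap b') g f = biprod_map b b' f g.
Proof. by rewrite /biprod_map addrC. Qed.
End Maps.

Lemma biprod_eqr x y (b : biprod x y) z (f g : hom b z) :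
  f ∘ inj1 b = g ∘ inj1 b -> f ∘ inj2 b = g ∘ inj2 b -> f = g.
Proof.
move=> e1 e2; rewrite -(comp1r f) -(comp1r g) -!biprod_sum !compDr !compA.
by rewrite e1 e2.
Qed.
Lemma biprod_eql x y (b : biprod x y) z (f g : hom z b) :
  prj1 b ∘ f = prj1 b ∘ g -> prj2 b ∘ f = prj2 b ∘ g -> f = g.
Proof.
move=> e1 e2; rewrite -(comp1l f) -(comp1l g) -!biprod_sum !compDl -!compA.
by rewrite e1 e2.
Qed.

End Biproducts.

Section ExactTheory.
Variables (k : fieldType) (B : exactCat k).
Implicit Types X Y Z E M T C : B.

Lemma exact_biprod X Y : {b : biprod X Y | True}.
Proof. exact: (cid (biprod_exists (ex_additive B) X Y)). Qed.
Definition biprod_of X Y : biprod X Y := sval (exact_biprod X Y).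
Local Notation "X ⊕ Y" := (biprod_of X Y) (at level 50).

Lemma ses_of_cokernel X E M (i : hom X E) (p : hom E M) :
  inflation i -> is_cokernel p i -> ses i p.
Proof.
move=> [N [q iq]] cp; have cq := ses_cokernel iq.
have [c [cE _]] := cq.2 _ _ cp.1; have [d [dE _]] := cp.2 _ _ cq.1.
apply: (ses_iso (a := idl X) (b := idl E) (c := c) _ _ _ _ _ iq);
  rewrite ?comp1l ?comp1r //; try exact: iso_id.
exists d; split.
  by apply: (cokernel_epi cq); rewrite -compA cE dE comp1l.
by apply: (cokernel_epi cp); rewrite -compA dE cE comp1l.
Qed.

Lemma ses_of_kernel X E M (i : hom X E) (p : hom E M) :
  deflation p -> is_kernel i p -> ses i p.
Proof.
move=> [N [j jp]] ki; have kj := ses_kernel jp.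
have [c [cE _]] := ki.2 _ _ kj.1; have [d [dE _]] := kj.2 _ _ ki.1.
apply: (ses_iso (a := c) (b := idl E) (c := idl M) _ _ _ _ _ jp);
  rewrite ?comp1l ?comp1r //; try exact: iso_id.
exists d; split.
  by apply: (kernel_mono kj); rewrite compA dE cE comp1r.
by apply: (kernel_mono ki); rewrite compA cE dE comp1r.
Qed.

Lemma inflation_iso X E E' (i : hom X E) (h : hom E E') :
  is_iso h -> inflation i -> inflation (h ∘ i).
Proof.
move=> hiso [M [p ip]]; have [g [gh hg]] := hiso.
exists M, (p ∘ g); apply: (ses_iso (iso_id X) hiso (iso_id M) _ _ ip).
  by rewrite comp1r.
by rewrite comp1l -compA gh comp1r.
Qed.

Lemma inflation_sum1 X E C (b : biprod X C) (b' : biprod E C) (i : hom X E) :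
  inflation i -> inflation (biprod_map b b' i (idl C)).
Proof.
move=> inf_i; have [E' [f [i' [[sq univ] inf_i']]]] :=
  inflation_pushout (inj1 b) inf_i.
have [|h [[hf hi'] _]] := univ _ (inj1 b') (biprod_map b b' i (idl C)).
  by rewrite map_inj1.
rewrite -hi'; apply: inflation_iso => //.
pose g := f ∘ prj1 b' + i' ∘ inj2 b ∘ prj2 b'.
have gE : g ∘ inj1 b' = f /\ g ∘ biprod_map b b' i (idl C) = i'.
  split.
    by rewrite compDl -!compA prj1inj1 prj2inj1 !comp0r comp1r addr0.
  apply: (biprod_eqr (b := b)); rewrite -compA ?map_inj1 ?map_inj2.
    by rewrite -sq compA compDl -!(compA _ _ (inj1 b')) prj1inj1 prj2inj1
      !comp0r comp1r addr0.
  by rewrite comp1r compDl -!compA prj1inj2 prj2inj2 !comp0r comp1r add0r.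
exists g; split.
  have [u [_ uP]] := univ _ _ _ sq.
  rewrite -(uP (g ∘ h)) ?(uP (idl E')) //; first by rewrite !comp1l.
  by rewrite -!compA hf hi'; exact: gE.
apply: (biprod_eqr (b := b')); rewrite comp1l -compA.
  by rewrite gE.1 hf.
rewrite compDl -!compA prj1inj2 prj2inj2 !comp0r comp1r add0r compA hi'.
by rewrite map_inj2 comp1r.
Qed.

Lemma inflation_sum X E X' E' (b : biprod X X') (b' : biprod E E')
    (i : hom X E) (i' : hom X' E') :
  inflation i -> inflation i' -> inflation (biprod_map b b' i i').
Proof.
move=> inf_i inf_i'.
have -> : biprod_map b b' i i' =
  biprod_map (X ⊕ E') b' i (idl E') ∘ biprod_map b (X ⊕ E') (idl X) i'.
  apply: (biprod_eqr (b := b)); rewrite -compA !(map_inj1, map_inj2) ?comp1r.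
    by rewrite map_inj1.
  by rewrite compA map_inj2 comp1r.
apply: inflation_comp; last exact: inflation_sum1.
rewrite -biprod_map_swap.
exact: (inflation_sum1 (biprod_swap b) (biprod_swap (X ⊕ E')) inf_i').
Qed.

Lemma cokernel_sum X E M X' E' M' (bX : biprod X X') (bE : biprod E E')
    (bM : biprod M M') (i : hom X E) (p : hom E M)
    (i' : hom X' E') (p' : hom E' M') :
  is_cokernel p i -> is_cokernel p' i' ->
  is_cokernel (biprod_map bE bM p p') (biprod_map bX bE i i').
Proof.
move=> cp cp'; split.
  by apply: (biprod_eqr (b := bX)); rewrite -compA !(map_inj1, map_inj2) compA
    !(map_inj1, map_inj2) -compA ?cp.1 ?cp'.1 !(comp0l, comp0r).
move=> T t t0.
have [|s [sE s_uniq]] := cp.2 T (t ∘ inj1 bE).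
  by rewrite -compA -(map_inj1 bX bE i i') compA t0 comp0l.
have [|s' [sE' s_uniq']] := cp'.2 T (t ∘ inj2 bE).
  by rewrite -compA -(map_inj2 bX bE i i') compA t0 comp0l.
exists (s ∘ prj1 bM + s' ∘ prj2 bM); split.
  rewrite compDl -!compA prj1_map prj2_map !compA sE sE' -!compA -compDr.
  by rewrite biprod_sum comp1r.
move=> r rE; apply: (biprod_eqr (b := bM)); rewrite compDl -!compA.
  rewrite prj1inj1 prj2inj1 comp0r comp1r addr0; apply: s_uniq.
  by rewrite -rE -!compA map_inj1.
rewrite prj1inj2 prj2inj2 comp0r comp1r add0r; apply: s_uniq'.
by rewrite -rE -!compA map_inj2.
Qed.

Lemma ses_sum X E M X' E' M' (bX : biprod X X') (bE : biprod E E')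
    (bM : biprod M M') (i : hom X E) (p : hom E M)
    (i' : hom X' E') (p' : hom E' M') :
  ses i p -> ses i' p' ->
  ses (biprod_map bX bE i i') (biprod_map bE bM p p').
Proof.
move=> ip ip'; apply: ses_of_cokernel.
  by apply: inflation_sum; [exists M, p|exists M', p'].
by apply: cokernel_sum; apply: ses_cokernel.
Qed.

Lemma ses_split X M (b : biprod X M) : ses (inj1 b) (prj2 b).
Proof.
apply: ses_of_cokernel.
  have [K [j jM]] := deflation_id M.
  have K0 : idl K = 0.
    have kj := ses_kernel jM; apply: (kernel_mono kj).
    by rewrite comp1r comp0r -kj.1 comp1l.
  have h1 : (0 : hom X K) ∘ (0 : hom K X) = idl K by rewrite comp0l K0.
  have h2 : (0 : hom K X) ∘ (0 : hom X K) + idl X ∘ idl X = idl X.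
    by rewrite comp0l add0r comp1l.
  have h3 : (0 : hom X K) ∘ idl X = 0 by rewrite comp0l.
  have h4 : idl X ∘ (0 : hom K X) = 0 by rewrite comp0r.
  have := inflation_sum1 (Biprod h1 (comp1l (idl X)) h3 h4 h2) (biprod_swap b)
    (ex_intro _ M (ex_intro _ (idl M) jM)).
  by rewrite /biprod_map /= !comp1r comp0r add0r.
split; first by rewrite prj2inj1.
move=> T t t0; exists (t ∘ inj2 b); split.
  apply: (biprod_eqr (b := b)); rewrite -!compA ?prj2inj1 ?prj2inj2.
    by rewrite !comp0r t0.
  by rewrite comp1r.
by move=> s <-; rewrite -compA prj2inj2 comp1r.
Qed.

(* Note the order of the arguments: [extension M X] is the type of short exact *)
(* sequences 0 -> X -> E -> M -> 0, and [Ext1 M X] is Ext^1(M,X).             *)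
Record extension (M X : B) := Extension {
  mid : B;
  inc : hom X mid;
  prj : hom mid M;
  extensionP : ses inc prj }.

Definition ext_mor M X M' X' (a : hom X X') (c : hom M M')
    (xi : extension M X) (eta : extension M' X') : Prop :=
  exists b : hom (mid xi) (mid eta),
    b ∘ inc xi = inc eta ∘ a /\ prj eta ∘ b = c ∘ prj xi.

Definition ext_equiv M X (xi eta : extension M X) : Prop :=
  exists b : hom (mid xi) (mid eta),
    [/\ is_iso b, b ∘ inc xi = inc eta & prj eta ∘ b = prj xi].

Lemma ext_mor_id M X (xi : extension M X) : ext_mor (idl X) (idl M) xi xi.
Proof. by exists (idl _); rewrite !(comp1l, comp1r). Qed.

Lemma ext_mor_comp M X M' X' M'' X'' (a : hom X X') (c : hom M M')
    (a' : hom X' X'') (c' : hom M' M'') (xi : extension M X)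
    (eta : extension M' X') (zeta : extension M'' X'') :
  ext_mor a' c' eta zeta -> ext_mor a c xi eta ->
  ext_mor (a' ∘ a) (c' ∘ c) xi zeta.
Proof.
move=> [b' [i' p']] [b [i p]]; exists (b' ∘ b); split.
  by rewrite -compA i compA i' compA.
by rewrite compA p' -compA p compA.
Qed.

Lemma ext_mor_add M X M' X' (a a' : hom X X') (c c' : hom M M')
    (xi : extension M X) (eta : extension M' X') :
  ext_mor a c xi eta -> ext_mor a' c' xi eta ->
  ext_mor (a + a') (c + c') xi eta.
Proof.
move=> [b [i p]] [b' [i' p']]; exists (b + b').
by rewrite !compDl !compDr i i' p p'.
Qed.

Lemma ext_mor_scale M X M' X' s (a : hom X X') (c : hom M M')
    (xi : extension M X) (eta : extension M' X') :
  ext_mor a c xi eta -> ext_mor (s *: a) (s *: c) xi eta.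
Proof.
move=> [b [i p]]; exists (s *: b).
by rewrite !compZl !compZr i p.
Qed.

Lemma ext_five M X (xi eta : extension M X) :
  ext_mor (idl X) (idl M) xi eta -> ext_equiv xi eta.
Proof.
move=> [b]; rewrite comp1r comp1l => -[bi pb]; exists b; split => //.
have kx := ses_kernel (extensionP xi); have ke := ses_kernel (extensionP eta).
have b_mono T (t : hom T (mid xi)) : b ∘ t = 0 -> t = 0.
  move=> bt; have [|s [sE _]] := kx.2 _ t; first by rewrite -pb -compA bt comp0r.
  suff -> : t = inc xi ∘ 0 by rewrite comp0r.
  rewrite -sE; congr (_ ∘ _); apply: (kernel_mono ke).
  by rewrite -bi -compA sE bt comp0r.
have [D [q' [q [[sq univ] [K [j jq]]]]]] := deflation_pullback (prj eta)
  (ex_intro _ X (ex_intro _ (inc xi) (extensionP xi))).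
have [kap [[kap1 kap2] _]] := univ X (inc xi) 0
  (etrans kx.1 (esym (comp0r _ _))).
have kkap : is_kernel kap q.
  split => // T t qt.
  have [|s [sE s_uniq]] := kx.2 _ (q' ∘ t).
    by rewrite compA sq -compA qt comp0r.
  exists s; split; last first.
    by move=> r rE; apply: s_uniq; rewrite -kap1 -compA rE.
  have [|u [_ u_uniq]] := univ T (q' ∘ t) 0.
    by rewrite compA sq -compA qt.
  by rewrite -(u_uniq t) // -(u_uniq (kap ∘ s)) // !compA kap1 kap2 sE comp0l.
have ckap := ses_cokernel (ses_of_kernel
  (ex_intro _ K (ex_intro _ j jq)) kkap).
have [|s [sE _]] := ke.2 _ (q - b ∘ q').
  by rewrite compBr compA pb sq subrr.
have skap : s ∘ kap = - idl X.
  apply: (kernel_mono ke); rewrite compA sE compBl kap2 -compA kap1 bi.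
  by rewrite sub0r compNr comp1r.
have [|c [cE _]] := ckap.2 _ (q' + inc xi ∘ s).
  by rewrite compDl kap1 -compA skap compNr comp1r subrr.
have bc : b ∘ c = idl _.
  apply: (cokernel_epi ckap); rewrite -compA cE compDr compA bi sE.
  by rewrite addrC subrK comp1l.
exists c; split => //; apply/eqP; rewrite -subr_eq0; apply/eqP/b_mono.
by rewrite compBr compA bc comp1l comp1r subrr.
Qed.

Lemma ext_equiv_mor M X (xi eta : extension M X) :
  ext_equiv xi eta -> ext_mor (idl X) (idl M) xi eta.
Proof. by move=> [b [_ i p]]; exists b; rewrite comp1l comp1r. Qed.

Lemma ext_equiv_refl M X (xi : extension M X) : ext_equiv xi xi.
Proof. exact/ext_five/ext_mor_id. Qed.

Lemma ext_equiv_sym M X (xi eta : extension M X) :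
  ext_equiv xi eta -> ext_equiv eta xi.
Proof.
move=> [b [[c [cb bc]] bi pb]]; exists c; split; first by exists b.
  by rewrite -bi compA cb comp1l.
by rewrite -pb -compA bc comp1r.
Qed.

Lemma ext_equiv_trans M X (xi eta zeta : extension M X) :
  ext_equiv xi eta -> ext_equiv eta zeta -> ext_equiv xi zeta.
Proof.
move=> /ext_equiv_mor h /ext_equiv_mor h'.
by apply: ext_five; have := ext_mor_comp h' h; rewrite !comp1l.
Qed.

Lemma pushout_extension M X X' (a : hom X X') (xi : extension M X) :
  exists eta : extension M X', exists f : hom (mid xi) (mid eta),
    is_pushout (inc xi) a f (inc eta) /\ prj eta ∘ f = prj xi.
Proof.
have cp := ses_cokernel (extensionP xi).
have [E' [f [i' [[sq univ] inf_i']]]] := inflation_pushout a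
  (ex_intro _ M (ex_intro _ (prj xi) (extensionP xi))).
have [|p' [[p'f p'i'] _]] := univ _ (prj xi) 0.
  by rewrite cp.1 comp0l.
have cp' : is_cokernel p' i'.
  split=> // T t ti'.
  have [|s [sE s_uniq]] := cp.2 _ (t ∘ f).
    by rewrite -compA sq compA ti' comp0l.
  exists s; split.
    have [|u [_ uP]] := univ _ (t ∘ f) 0.
      by rewrite -compA sq compA ti' !comp0l.
    by rewrite -(uP t) // -(uP (s ∘ p')) // -!compA p'f p'i' comp0r sE.
  by move=> r rE; apply: s_uniq; rewrite -p'f compA rE.
by exists (Extension (ses_of_cokernel inf_i' cp')), f.
Qed.

Lemma pullback_extension M M' X (c : hom M' M) (xi : extension M X) :
  exists eta : extension M' X, exists f : hom (mid eta) (mid xi),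
    is_pullback (prj xi) c f (prj eta) /\ f ∘ inc eta = inc xi.
Proof.
have ki := ses_kernel (extensionP xi).
have [E' [f [p' [[sq univ] def_p']]]] := deflation_pullback c
  (ex_intro _ X (ex_intro _ (inc xi) (extensionP xi))).
have [|i' [[fi' p'i'] _]] := univ _ (inc xi) 0.
  by rewrite ki.1 comp0r.
have ki' : is_kernel i' p'.
  split=> // T t p't.
  have [|s [sE s_uniq]] := ki.2 _ (f ∘ t).
    by rewrite compA sq -compA p't comp0r.
  exists s; split.
    have [|u [_ uP]] := univ _ (f ∘ t) 0.
      by rewrite compA sq -compA p't.
    by rewrite -(uP t) // -(uP (i' ∘ s)) // !compA fi' p'i' comp0l sE.
  by move=> r rE; apply: s_uniq; rewrite -fi' -compA rE.
by exists (Extension (ses_of_kernel def_p' ki')), f.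
Qed.

Definition ext_pushout M X X' (a : hom X X') (xi : extension M X) :
  extension M X' := sval (cid (pushout_extension a xi)).

Definition ext_pullback M M' X (c : hom M' M) (xi : extension M X) :
  extension M' X := sval (cid (pullback_extension c xi)).

Definition ext_sum M X M' X' (xi : extension M X) (eta : extension M' X') :
  extension (M ⊕ M') (X ⊕ X') :=
  Extension (ses_sum (X ⊕ X') (mid xi ⊕ mid eta) (M ⊕ M')
    (extensionP xi) (extensionP eta)).

Definition ext_split M X : extension M X := Extension (ses_split (X ⊕ M)).

Definition baer_sum M X (xi eta : extension M X) : extension M X :=
  ext_pushout (codiagonal (X ⊕ X))
    (ext_pullback (diagonal (M ⊕ M)) (ext_sum xi eta)).

Lemma ext_pushoutP M X X' (a : hom X X') (xi : extension M X) :
  ext_mor a (idl M) xi (ext_pushout a xi).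
Proof.
rewrite /ext_pushout; case: cid => /= eta [f [[sq _] e]].
by exists f; rewrite comp1l.
Qed.

Lemma ext_pullbackP M M' X (c : hom M' M) (xi : extension M X) :
  ext_mor (idl X) c (ext_pullback c xi) xi.
Proof.
rewrite /ext_pullback; case: cid => /= eta [f [[sq _] e]].
by exists f; rewrite comp1r.
Qed.

Lemma ext_pushout_univ M X X' M' X'' (a : hom X X') (a' : hom X' X'')
    (c : hom M M') (xi : extension M X) (eta : extension M' X'') :
  ext_mor (a' ∘ a) c xi eta -> ext_mor a' c (ext_pushout a xi) eta.
Proof.
move=> [b [bi pb]]; rewrite /ext_pushout; case: cid => /= zeta [f [[sq univ] e]].
have [|h [[hf hi] _]] := univ _ b (inc eta ∘ a'); first by rewrite bi compA.
exists h; split => //.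
have [|u [_ uP]] := univ _ (prj eta ∘ b) 0.
  by rewrite -compA bi compA (ses_kernel (extensionP eta)).1 !comp0l.
transitivity u; [symmetry|]; apply: uP; split.
- by rewrite -!compA hf.
- by rewrite -!compA hi compA (ses_kernel (extensionP eta)).1 comp0l.
- by rewrite -!compA e pb.
- by rewrite -!compA (ses_kernel (extensionP zeta)).1 comp0r.
Qed.

Lemma ext_pullback_univ M X M' M'' X' (a : hom X X') (c : hom M M')
    (c' : hom M' M'') (xi : extension M X) (eta : extension M'' X') :
  ext_mor a (c' ∘ c) xi eta -> ext_mor a c xi (ext_pullback c' eta).
Proof.
move=> [b [bi pb]]; rewrite /ext_pullback; case: cid => /= zeta [f [[sq univ] e]].
have [|h [[fh ph] _]] := univ _ b (c ∘ prj xi); first by rewrite pb compA.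
exists h; split => //.
have [|u [_ uP]] := univ _ (b ∘ inc xi) 0.
  by rewrite compA pb -!compA (ses_kernel (extensionP xi)).1 !comp0r.
transitivity u; [symmetry|]; apply: uP; split.
- by rewrite !compA fh.
- by rewrite !compA ph -compA (ses_kernel (extensionP xi)).1 comp0r.
- by rewrite !compA e bi.
- by rewrite !compA (ses_kernel (extensionP zeta)).1 comp0l.
Qed.

Lemma ext_pushout_uniq M X X' (a : hom X X') (xi : extension M X)
    (eta : extension M X') :
  ext_mor a (idl M) xi eta -> ext_equiv (ext_pushout a xi) eta.
Proof. by rewrite -[a in ext_mor a]comp1l => /ext_pushout_univ/ext_five. Qed.

Lemma ext_pullback_uniq M M' X (c : hom M' M) (xi : extension M' X)
    (eta : extension M X) :
  ext_mor (idl X) c xi eta -> ext_equiv xi (ext_pullback c eta).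
Proof. by rewrite -[c in ext_mor _ c]comp1r => /ext_pullback_univ/ext_five. Qed.

Lemma ext_sum_prj1 M X M' X' (xi : extension M X) (eta : extension M' X') :
  ext_mor (prj1 (X ⊕ X')) (prj1 (M ⊕ M')) (ext_sum xi eta) xi.
Proof. by exists (prj1 _); rewrite /= !prj1_map. Qed.
Lemma ext_sum_prj2 M X M' X' (xi : extension M X) (eta : extension M' X') :
  ext_mor (prj2 (X ⊕ X')) (prj2 (M ⊕ M')) (ext_sum xi eta) eta.
Proof. by exists (prj2 _); rewrite /= !prj2_map. Qed.
Lemma ext_sum_inj1 M X M' X' (xi : extension M X) (eta : extension M' X') :
  ext_mor (inj1 (X ⊕ X')) (inj1 (M ⊕ M')) xi (ext_sum xi eta).
Proof. by exists (inj1 _); rewrite /= !map_inj1. Qed.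
Lemma ext_sum_inj2 M X M' X' (xi : extension M X) (eta : extension M' X') :
  ext_mor (inj2 (X ⊕ X')) (inj2 (M ⊕ M')) eta (ext_sum xi eta).
Proof. by exists (inj2 _); rewrite /= !map_inj2. Qed.

Lemma ext_joint M X X' (xi : extension M X) (eta : extension M X') :
  exists zeta : extension M (X ⊕ X'),
    ext_mor (prj1 (X ⊕ X')) (idl M) zeta xi /\
    ext_mor (prj2 (X ⊕ X')) (idl M) zeta eta.
Proof.
have h := ext_pullbackP (diagonal (M ⊕ M)) (ext_sum xi eta).
exists (ext_pullback (diagonal (M ⊕ M)) (ext_sum xi eta)); split.
  have := ext_mor_comp (ext_sum_prj1 xi eta) h.
  by rewrite comp1r compDr prj1inj1 prj1inj2 addr0.
have := ext_mor_comp (ext_sum_prj2 xi eta) h.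
by rewrite comp1r compDr prj2inj1 prj2inj2 add0r.
Qed.

Lemma baer_sum_mor M Y X (f g : hom Y X) (zeta : extension M Y)
    (xi eta : extension M X) :
  ext_mor f (idl M) zeta xi -> ext_mor g (idl M) zeta eta ->
  ext_mor (f + g) (idl M) zeta (baer_sum xi eta).
Proof.
move=> /(ext_mor_comp (ext_sum_inj1 xi eta)) h1.
move=> /(ext_mor_comp (ext_sum_inj2 xi eta)) h2.
have := ext_mor_add h1 h2; rewrite !comp1r -/(diagonal (M ⊕ M)).
rewrite -[diagonal _]comp1r => /ext_pullback_univ h.
have := ext_mor_comp (ext_pushoutP (codiagonal (X ⊕ X)) _) h.
rewrite comp1l /codiagonal compDr !compDl !compA.
by rewrite !(prj1inj1, prj1inj2, prj2inj1, prj2inj2) !(comp1l, comp0l) addr0 add0r.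
Qed.

Lemma ext_mor_split M Y X (zeta : extension M Y) :
  ext_mor (0 : hom Y X) (idl M) zeta (ext_split M X).
Proof.
exists (inj2 (X ⊕ M) ∘ prj zeta).
rewrite /= -compA (ses_kernel (extensionP zeta)).1 !comp0r.
by rewrite compA prj2inj2.
Qed.

End ExactTheory.

Section Ext.
Variables (k : fieldType) (B : exactCat k).

HB.instance Definition _ (M X : B) := gen_eqMixin (extension M X).
HB.instance Definition _ (M X : B) := gen_choiceMixin (extension M X).

Section OneHom.
Variables M X : B.

Definition ext_rel : rel (extension M X) := fun xi eta => `[< ext_equiv xi eta >].

Fact ext_rel_equiv : equiv_class_of ext_rel.
Proof.
split=> [xi|xi eta|eta xi zeta]; first exact/asboolP/ext_equiv_refl.
  by apply/asboolP/asboolP => /ext_equiv_sym.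
by move=> /asboolP h /asboolP h'; apply/asboolP/(ext_equiv_trans h h').
Qed.
Canonical ext_rel_equiv_rel := EquivRelPack ext_rel_equiv.
Canonical ext_rel_encModRel := defaultEncModRel ext_rel.

(* Yoneda's Ext^1; addition is the Baer sum, and functoriality in the two     *)
(* variables is pullback and pushout of extensions. Operations on classes are *)
(* computed on chosen representatives; Ext1_push_cl, Ext1_pull_cl and         *)
(* Ext1_add_cl below show that the choice is immaterial.                      *)
Definition Ext1 := {eq_quot ext_rel}.
HB.instance Definition _ := Choice.on Ext1.
HB.instance Definition _ := EqQuotient.on Ext1.

Definition ext_cl (xi : extension M X) : Ext1 := \pi_{eq_quot ext_rel} xi.
Definition ext_rep (u : Ext1) : extension M X := repr (u : {eq_quot ext_rel}).

Lemma ext_repK u : ext_cl (ext_rep u) = u.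
Proof. exact: reprK. Qed.

Lemma ext_clE xi eta : ext_cl xi = ext_cl eta <-> ext_equiv xi eta.
Proof.
split=> [|h]; first by move/eqP; rewrite piE => /asboolP.
by apply/eqP; rewrite piE; apply/asboolP.
Qed.

Lemma ext_clP (u : Ext1) : exists xi, u = ext_cl xi.
Proof. by exists (ext_rep u); rewrite ext_repK. Qed.

End OneHom.

Definition Ext1_push M X X' (a : hom X X') (u : Ext1 M X) : Ext1 M X' :=
  ext_cl (ext_pushout a (ext_rep u)).
Definition Ext1_pull M M' X (c : hom M' M) (u : Ext1 M X) : Ext1 M' X :=
  ext_cl (ext_pullback c (ext_rep u)).

Lemma Ext1_push_cl M X X' (a : hom X X') (xi : extension M X) :
  Ext1_push a (ext_cl xi) = ext_cl (ext_pushout a xi).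
Proof.
apply/ext_clE/ext_pushout_uniq; set eta := ext_rep _.
have /ext_clE/ext_equiv_mor h : ext_cl eta = ext_cl xi by rewrite ext_repK.
by have := ext_mor_comp (ext_pushoutP a xi) h; rewrite comp1r comp1l.
Qed.

Lemma Ext1_pull_cl M M' X (c : hom M' M) (xi : extension M X) :
  Ext1_pull c (ext_cl xi) = ext_cl (ext_pullback c xi).
Proof.
apply/ext_clE/ext_pullback_uniq; set eta := ext_rep _.
have /ext_clE/ext_equiv_mor h : ext_cl eta = ext_cl xi by rewrite ext_repK.
by have := ext_mor_comp h (ext_pullbackP c eta); rewrite comp1r comp1l.
Qed.

Lemma Ext1_morP M X M' X' (a : hom X X') (c : hom M M')
    (xi : extension M X) (eta : extension M' X') :
  ext_mor a c xi eta <-> Ext1_push a (ext_cl xi) = Ext1_pull c (ext_cl eta).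
Proof.
rewrite Ext1_push_cl Ext1_pull_cl ext_clE; split.
  rewrite -[a in ext_mor a]comp1l => /ext_pushout_univ.
  by rewrite -[c in ext_mor _ c]comp1r => /ext_pullback_univ/ext_five.
move=> /ext_equiv_mor h.
have := ext_mor_comp (ext_pullbackP c eta) (ext_mor_comp h (ext_pushoutP a xi)).
by rewrite !comp1l comp1r.
Qed.

Lemma Ext1_push1 M X (u : Ext1 M X) : Ext1_push (idl X) u = u.
Proof.
have [xi ->] := ext_clP u; rewrite Ext1_push_cl.
exact/ext_clE/ext_pushout_uniq/ext_mor_id.
Qed.

Lemma Ext1_pull1 M X (u : Ext1 M X) : Ext1_pull (idl M) u = u.
Proof.
have [xi ->] := ext_clP u; rewrite Ext1_pull_cl; symmetry.
exact/ext_clE/ext_pullback_uniq/ext_mor_id.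
Qed.

Lemma Ext1_pushM M X X' X'' (a' : hom X' X'') (a : hom X X') (u : Ext1 M X) :
  Ext1_push (a' ∘ a) u = Ext1_push a' (Ext1_push a u).
Proof.
have [xi ->] := ext_clP u; rewrite !Ext1_push_cl.
apply/ext_clE/ext_pushout_uniq; rewrite -[idl M]comp1l.
exact: ext_mor_comp (ext_pushoutP _ _) (ext_pushoutP _ _).
Qed.

Lemma Ext1_pullM M M' M'' X (c' : hom M' M'') (c : hom M M') (u : Ext1 M'' X) :
  Ext1_pull (c' ∘ c) u = Ext1_pull c (Ext1_pull c' u).
Proof.
have [xi ->] := ext_clP u; rewrite !Ext1_pull_cl; symmetry.
apply/ext_clE/ext_pullback_uniq; rewrite -[idl X]comp1l.
exact: ext_mor_comp (ext_pullbackP _ _) (ext_pullbackP _ _).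
Qed.

Lemma Ext1_push_pull M M' X X' (a : hom X X') (c : hom M' M) (u : Ext1 M X) :
  Ext1_push a (Ext1_pull c u) = Ext1_pull c (Ext1_push a u).
Proof.
have [xi ->] := ext_clP u; rewrite Ext1_pull_cl (Ext1_push_cl a xi).
have := ext_mor_comp (ext_pushoutP a xi) (ext_pullbackP c xi).
by rewrite comp1r comp1l => /Ext1_morP.
Qed.

Definition Ext1_zero M X : Ext1 M X := ext_cl (ext_split M X).
Definition Ext1_add M X (u v : Ext1 M X) : Ext1 M X :=
  ext_cl (baer_sum (ext_rep u) (ext_rep v)).
Definition Ext1_opp M X (u : Ext1 M X) : Ext1 M X := Ext1_push (- idl X) u.
Definition Ext1_scale M X (s : k) (u : Ext1 M X) : Ext1 M X :=
  Ext1_push (s *: idl X) u.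

Lemma Ext1_push0 M X X' (u : Ext1 M X) : Ext1_push (0 : hom X X') u = Ext1_zero M X'.
Proof.
have [xi ->] := ext_clP u.
by rewrite -[RHS]Ext1_pull1; apply/Ext1_morP/ext_mor_split.
Qed.

Lemma Ext1_push_add M X X' (a a' : hom X X') (u : Ext1 M X) :
  Ext1_push (a + a') u = Ext1_add (Ext1_push a u) (Ext1_push a' u).
Proof.
have [xi uE] := ext_clP u; rewrite -[RHS]Ext1_pull1 {1}uE; apply/Ext1_morP.
by apply: baer_sum_mor; apply/Ext1_morP; rewrite ext_repK Ext1_pull1 uE.
Qed.

Lemma Ext1_joint M X X' (u : Ext1 M X) (v : Ext1 M X') :
  exists Y (w : Ext1 M Y) (f : hom Y X) (g : hom Y X'),
    u = Ext1_push f w /\ v = Ext1_push g w.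
Proof.
have [xi ->] := ext_clP u; have [eta ->] := ext_clP v.
have [zeta [/Ext1_morP h /Ext1_morP h']] := ext_joint xi eta.
exists (biprod_of X X'), (ext_cl zeta), (prj1 _), (prj2 _).
by rewrite h h' !Ext1_pull1.
Qed.

Lemma Ext1_add_cl M X (xi eta : extension M X) :
  Ext1_add (ext_cl xi) (ext_cl eta) = ext_cl (baer_sum xi eta).
Proof.
have [zeta [h h']] := ext_joint xi eta.
have /Ext1_morP := baer_sum_mor h h'; rewrite Ext1_pull1 Ext1_push_add => <-.
by move/Ext1_morP: h => ->; move/Ext1_morP: h' => ->; rewrite !Ext1_pull1.
Qed.

Section LmodStructure.
Variables M X : B.
Implicit Types u v w : Ext1 M X.

Fact Ext1_addA : associative (@Ext1_add M X).
Proof.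
move=> u v w; have [Y [z [f [g [-> ->]]]]] := Ext1_joint u v.
have [Y' [z' [f' [g' [-> ->]]]]] := Ext1_joint z w.
by rewrite -!Ext1_pushM -!Ext1_push_add addrA.
Qed.
Fact Ext1_addC : commutative (@Ext1_add M X).
Proof.
move=> u v; have [Y [z [f [g [-> ->]]]]] := Ext1_joint u v.
by rewrite -!Ext1_push_add addrC.
Qed.
Fact Ext1_add0 : left_id (Ext1_zero M X) (@Ext1_add M X).
Proof.
move=> u; rewrite -(Ext1_push0 X u) -{2}(Ext1_push1 u) -Ext1_push_add.
by rewrite add0r Ext1_push1.
Qed.
Fact Ext1_addN : left_inverse (Ext1_zero M X) (@Ext1_opp M X) (@Ext1_add M X).
Proof.
move=> u; rewrite /Ext1_opp -{2}(Ext1_push1 u) -Ext1_push_add addNr.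
exact: Ext1_push0.
Qed.
HB.instance Definition _ := GRing.isZmodule.Build (Ext1 M X)
  Ext1_addA Ext1_addC Ext1_add0 Ext1_addN.

Fact Ext1_scaleA a b u : Ext1_scale a (Ext1_scale b u) = Ext1_scale (a * b) u.
Proof. by rewrite /Ext1_scale -Ext1_pushM compZl comp1l scalerA. Qed.
Fact Ext1_scale1 : left_id 1 (@Ext1_scale M X).
Proof. by move=> u; rewrite /Ext1_scale scale1r Ext1_push1. Qed.
Fact Ext1_scaleDr : right_distributive (@Ext1_scale M X) +%R.
Proof.
move=> a u v; have [Y [z [f [g [-> ->]]]]] := Ext1_joint u v.
rewrite /Ext1_scale -![_ + _]Ext1_push_add -!Ext1_pushM.
by rewrite compDr Ext1_push_add.
Qed.
Fact Ext1_scaleDl u : {morph (@Ext1_scale M X)^~ u : a b / a + b}.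
Proof. by move=> a b; rewrite /Ext1_scale scalerDl Ext1_push_add. Qed.
HB.instance Definition _ := GRing.Zmodule_isLmodule.Build k (Ext1 M X)
  Ext1_scaleA Ext1_scale1 Ext1_scaleDr Ext1_scaleDl.

End LmodStructure.

Lemma Ext1_pushD M X X' (a a' : hom X X') (u : Ext1 M X) :
  Ext1_push (a + a') u = Ext1_push a u + Ext1_push a' u.
Proof. exact: Ext1_push_add. Qed.

Lemma Ext1_scaleE M X s (u : Ext1 M X) : s *: u = Ext1_push (s *: idl X) u.
Proof. by []. Qed.

Lemma Ext1_push_linear M X X' (a : hom X X') : linear (@Ext1_push M X X' a).
Proof.
move=> s u v; have [Y [z [f [g [-> ->]]]]] := Ext1_joint u v.
rewrite !Ext1_scaleE -!Ext1_pushM -!Ext1_pushD -Ext1_pushM.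
by rewrite !compDr !compZl !compZr !comp1l.
Qed.

Lemma Ext1_pull_linear M M' X (c : hom M' M) : linear (@Ext1_pull M M' X c).
Proof.
move=> s u v; have [Y [z [f [g [-> ->]]]]] := Ext1_joint u v.
rewrite !Ext1_scaleE -!Ext1_pushM -!Ext1_pushD -!Ext1_push_pull.
by rewrite -!Ext1_pushM -Ext1_pushD.
Qed.

Lemma Ext1_pullD M M' X (c c' : hom M' M) (u : Ext1 M X) :
  Ext1_pull (c + c') u = Ext1_pull c u + Ext1_pull c' u.
Proof.
have [xi uE] := ext_clP u.
have [Y [w [f [g [e e']]]]] := Ext1_joint (Ext1_pull c u) (Ext1_pull c' u).
have [zeta wE] := ext_clP w; rewrite e e' -Ext1_pushD uE wE.
symmetry; apply/Ext1_morP/ext_mor_add; apply/Ext1_morP.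
  by rewrite -uE -wE e.
by rewrite -uE -wE e'.
Qed.

Lemma Ext1_pushB M X X' (a a' : hom X X') (u : Ext1 M X) :
  Ext1_push (a - a') u = Ext1_push a u - Ext1_push a' u.
Proof.
apply/eqP; rewrite -(inj_eq (addIr (Ext1_push a' u))) -Ext1_pushD.
by rewrite !subrK.
Qed.

Lemma Ext1_pullB M M' X (c c' : hom M' M) (u : Ext1 M X) :
  Ext1_pull (c - c') u = Ext1_pull c u - Ext1_pull c' u.
Proof.
apply/eqP; rewrite -(inj_eq (addIr (Ext1_pull c' u))) -Ext1_pullD.
by rewrite !subrK.
Qed.

Lemma Ext1_push_0 M X X' (a : hom X X') : Ext1_push a (0 : Ext1 M X) = 0.
Proof.
by rewrite -[X in Ext1_push a X](subrr (0 : Ext1 M X)) -scaleN1r addrC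
  Ext1_push_linear scaleN1r addNr.
Qed.

Lemma Ext1_pull_0 M M' X (c : hom M' M) : Ext1_pull c (0 : Ext1 M X) = 0.
Proof.
by rewrite -[X in Ext1_pull c X](subrr (0 : Ext1 M X)) -scaleN1r addrC
  Ext1_pull_linear scaleN1r addNr.
Qed.

(* Exactness of Hom(T,E) -> Hom(T,M) -> Ext1(T,X).                            *)
Lemma Ext1_pull_eq0 M X T (xi : extension M X) (c : hom T M) :
  Ext1_pull c (ext_cl xi) = 0 <-> exists g, c = prj xi ∘ g.
Proof.
split=> [h|[g ->]].
  have /Ext1_morP[b [_ pb]] :
      Ext1_push (idl X) (ext_cl (ext_split T X)) = Ext1_pull c (ext_cl xi).
    by rewrite h Ext1_push1.
  exists (b ∘ inj2 (biprod_of X T)).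
  by rewrite compA pb /= -compA prj2inj2 comp1r.
rewrite -[RHS](Ext1_push0 X (Ext1_zero T X)); symmetry; apply/Ext1_morP.
exists (g ∘ prj2 (biprod_of X T)); split; last by rewrite compA.
by rewrite comp0r -compA prj2inj1 comp0r.
Qed.

(* Exactness of Hom(E,Y) -> Hom(X,Y) -> Ext1(M,Y).                            *)
Lemma Ext1_push_eq0 M X Y (xi : extension M X) (a : hom X Y) :
  Ext1_push a (ext_cl xi) = 0 <-> exists h, a = h ∘ inc xi.
Proof.
split=> [h|[h ->]].
  have /Ext1_morP[b [ib _]] :
      Ext1_push a (ext_cl xi) = Ext1_pull (idl M) (ext_cl (ext_split M Y)).
    by rewrite h Ext1_pull1.
  exists (prj1 (biprod_of Y M) ∘ b).
  by rewrite -compA ib /= compA prj1inj1 comp1l.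
rewrite -[RHS]Ext1_pull1; apply/Ext1_morP.
exists (inj1 (biprod_of Y M) ∘ h + inj2 (biprod_of Y M) ∘ prj xi); split.
  rewrite compDl -!(compA (inj2 _)) (ses_kernel (extensionP xi)).1.
  by rewrite comp0r addr0 compA.
by rewrite compDr !compA prj2inj1 prj2inj2 comp0l comp1l add0r.
Qed.

Definition projective (P : B) : Prop :=
  forall X Y (p : hom X Y) (f : hom P Y), deflation p -> exists g, f = p ∘ g.

Definition injective_obj (J : B) : Prop :=
  forall X Y (i : hom X Y) (f : hom X J), inflation i -> exists g, f = g ∘ i.

Definition enough_projectives : Prop :=
  forall X, exists P (p : hom P X), projective P /\ deflation p.

Definition enough_injectives : Prop :=
  forall X, exists J (i : hom X J), injective_obj J /\ inflation i.

Fact projective_iso X Y : isomorphic X Y -> projective X -> projective Y.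
Proof.
move=> [f [g [gf fg]]] pX E N p h defp; have [l e] := pX _ _ p (h ∘ f) defp.
by exists (l ∘ g); rewrite compA -e -compA fg comp1r.
Qed.
Fact projective_dsum n (Y : 'I_n -> B) s :
  is_dsum Y s -> (forall j, projective (Y j)) -> projective s.
Proof.
move=> [i [p [_ _ sum1]]] pY E N q h defq.
have /all_sig[l lE] j : {l | h ∘ i j = q ∘ l}.
  exact/cid/(pY j _ _ q (h ∘ i j) defq).
exists (\sum_j l j ∘ p j); rewrite comp_sumr -[LHS]comp1r -sum1 comp_sumr.
by apply: eq_bigr => j _; rewrite !compA lE.
Qed.

Definition projectives : subcat B := Subcat projective_iso projective_dsum.

Lemma projective_Ext1 P X (u : Ext1 P X) : projective P -> u = 0.
Proof.
move=> pP; have [xi ->] := ext_clP u; rewrite -[LHS]Ext1_pull1.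
apply/Ext1_pull_eq0; apply: pP.
by exists X, (inc xi); apply: extensionP.
Qed.

Definition rigid (M : B -> Prop) : Prop :=
  forall X Y, M X -> M Y -> forall u : Ext1 X Y, u = 0.

End Ext.

Section Modules.
Variables (k : fieldType) (D : linCat k).

(* Objects of Mod D: only additivity is required on morphisms; for finitely   *)
(* presented functors k-linearity on morphisms is automatic.                  *)
Record cofunctor := Cofunctor {
  cf_ob :> D -> lmodType k;
  cf_fin : forall x, finite_dim (cf_ob x);
  cf_map : forall x y, hom x y -> cf_ob y -> cf_ob x;
  cf_linear : forall x y (f : hom x y), linear (cf_map f);
  cf_id : forall x v, cf_map (idl x) v = v;
  cf_comp : forall x y z (g : hom y z) (f : hom x y) v,
    cf_map (g ∘ f) v = cf_map f (cf_map g v);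
  cf_add : forall x y (f g : hom x y) v,
    cf_map (f + g) v = cf_map f v + cf_map g v }.
Arguments cf_map A {x y} f v : rename.

Record nat_trans (A A' : cofunctor) := NatTrans {
  nt :> forall x, A x -> A' x;
  nt_linear : forall x, linear (@nt x);
  nt_natural : forall x y (f : hom x y) v,
    @nt x (cf_map A f v) = cf_map A' f (@nt y v) }.
Arguments nt {A A'} t x v : rename.

Lemma nat_trans_eq A A' (t t' : nat_trans A A') :
  (forall x v, t x v = t' x v) -> t = t'.
Proof.
case: t t' => [t tl tn] [t' tl' tn'] /= e.
have {}e : t = t'.
  by apply: functional_extensionality_dep => x; apply/funext/e.
by case: _ / e in tl' tn' *; congr NatTrans; apply: Prop_irrelevance.
Qed.

Definition nat_id A : nat_trans A A :=
  @NatTrans A A (fun x v => v) (fun _ _ _ _ => erefl) (fun _ _ _ _ => erefl).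

Section NatComp.
Variables (A A' A'' : cofunctor) (t' : nat_trans A' A'') (t : nat_trans A A').
Fact nat_comp_linear x : linear (fun v => t' x (t x v)).
Proof. by move=> a v w; rewrite !nt_linear. Qed.
Fact nat_comp_natural x y (f : hom x y) v :
  t' x (t x (cf_map A f v)) = cf_map A'' f (t' y (t y v)).
Proof. by rewrite !nt_natural. Qed.
Definition nat_comp : nat_trans A A'' := NatTrans nat_comp_linear nat_comp_natural.
End NatComp.

Fact nat_compA A A' A'' A''' (r : nat_trans A'' A''') (s : nat_trans A' A'')
    (t : nat_trans A A') :
  nat_comp r (nat_comp s t) = nat_comp (nat_comp r s) t.
Proof. exact: nat_trans_eq. Qed.
Fact nat_comp1l A A' (t : nat_trans A A') : nat_comp (nat_id A') t = t.
Proof. exact: nat_trans_eq. Qed.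
Fact nat_comp1r A A' (t : nat_trans A A') : nat_comp t (nat_id A) = t.
Proof. exact: nat_trans_eq. Qed.

Definition Mod : category :=
  @Category cofunctor nat_trans nat_id (fun _ _ _ t' t => nat_comp t' t)
    nat_compA nat_comp1l nat_comp1r.

Definition representable (d : D) : cofunctor :=
  @Cofunctor (fun x => hom x d) (fun x => hom_fin x d) (fun x y f g => g ∘ f)
    (fun x y f => comp_linl f) (fun _ _ => comp1r _)
    (fun _ _ _ _ _ _ => compA _ _ _) (fun _ _ _ _ _ => compDr _ _ _).

Definition finitely_presented (A : cofunctor) : Prop :=
  exists (d1 d0 : D) (phi : nat_trans (representable d1) (representable d0))
         (eps : nat_trans (representable d0) A),
    forall x,
      (forall v, eps x v = 0 <-> exists u, phi x u = v) /\
      (forall a, exists v, eps x v = a).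

Definition modfp : category := @full_sub Mod finitely_presented.

End Modules.
Arguments cf_map {k D} A {x y} f v : rename.
Arguments nt {k D A A'} t x v : rename.

Section TheFunctor.
Variables (k : fieldType) (B : exactCat k) (M : subcat B).

(* Since M contains the projectives in the situation of interest, factoring   *)
(* through a projective in B or in M is the same.                             *)
Definition stable_cat : linCat k :=
  quot_cat (full_ideal M (factor_ideal (ex_additive B) (projectives B))).

(* The sequence 0 -> X -> M^0 -> M^1 -> 0 is written with M0, M1.             *)
Definition ML (X : B) : Prop :=
  exists (M0 M1 : B) (i : hom X M0) (p : hom M0 M1), [/\ M M0, M M1 & ses i p].

Definition ML_cat : linCat k := full_lin ML.

Definition ML_quot : linCat k :=
  quot_cat (full_ideal ML (factor_ideal (ex_additive B) M)).

Hypothesis Mrigid : rigid M.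

(* Morphisms factoring through a projective act as zero on Ext1(-,X), so that *)
(* Ext1(-,X) is defined on stable_cat.                                        *)
Lemma stable_pull X (N N' : stable_cat) (f : hom (sval N) (sval N'))
    (u : Ext1 (sval N') X) :
  Ext1_pull (lmod_quot_repr (lmod_quot_pi _ f : hom N N')) u = Ext1_pull f u.
Proof.
have /asboolP[P pP [g [h e]]] := lmod_quot_reprB (full_ideal M
  (factor_ideal (ex_additive B) (projectives B)) N N') f.
apply/eqP; rewrite -subr_eq0 -Ext1_pullB e; apply/eqP.
by rewrite Ext1_pullM (projective_Ext1 (Ext1_pull g u) pP) Ext1_pull_0.
Qed.

Section OnObjects.
Variables (X : B) (X_ML : ML X).

Definition H_map (N N' : stable_cat) (f : hom N N') (u : Ext1 (sval N') X) :
  Ext1 (sval N) X := Ext1_pull (lmod_quot_repr f) u.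

Fact H_id (N : stable_cat) u : H_map (idl N) u = u.
Proof. by rewrite /H_map stable_pull Ext1_pull1. Qed.

Fact H_comp (N N' N'' : stable_cat) (g : hom N' N'') (f : hom N N') u :
  H_map (g ∘ f) u = H_map f (H_map g u).
Proof. by rewrite /H_map stable_pull Ext1_pullM. Qed.

Fact H_add (N N' : stable_cat) (f g : hom N N') u :
  H_map (f + g) u = H_map f u + H_map g u.
Proof.
rewrite -{1}(lmod_quot_reprK f) -{1}(lmod_quot_reprK g) -lmod_quot_piD.
by rewrite /H_map stable_pull Ext1_pullD.
Qed.

(* A sequence 0 -> X -> M0 -> M1 -> 0 with class w presents Ext1(-,X) on M.   *)
Lemma ML_presentation : exists (M0 M1 : stable_cat)
    (p : hom (sval M0) (sval M1)) (w : Ext1 (sval M1) X),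
  forall N : stable_cat,
    (forall c : hom (sval N) (sval M1),
      Ext1_pull c w = 0 <-> exists g, c = p ∘ g) /\
    (forall u : Ext1 (sval N) X, exists c, Ext1_pull c w = u).
Proof.
have [M0 [M1 [i [p [M0M M1M ip]]]]] := X_ML.
exists (exist _ M0 M0M), (exist _ M1 M1M), p, (ext_cl (Extension ip)).
move=> [N NM] /=; split=> [c|u]; first exact: Ext1_pull_eq0.
have [eta ->] := ext_clP u.
have /Ext1_push_eq0[h hi] : Ext1_push i (ext_cl eta) = 0 by apply: Mrigid.
have [|g [gE _]] := (ses_cokernel (extensionP eta)).2 _ (p ∘ h).
  by rewrite -compA -hi (ses_kernel ip).1.
exists g; rewrite -[RHS]Ext1_push1; symmetry; apply/Ext1_morP.
by exists h; rewrite /= comp1r.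
Qed.

Fact H_fin (N : stable_cat) : finite_dim (Ext1 (sval N) X : lmodType k).
Proof.
have [M0 [M1 [p [w /(_ N)[_ wsurj]]]]] := ML_presentation.
pose f (c : hom (sval N) (sval M1)) : (Ext1 (sval N) X : lmodType k) :=
  Ext1_pull c w.
have f_lin : linear f.
  move=> a c c'; rewrite /f Ext1_pullD; congr (_ + _).
  have [xi ->] := ext_clP w.
  have /(ext_mor_scale a)/Ext1_morP := ext_pullbackP c xi.
  by rewrite -Ext1_pull_cl => <-.
pose g : {linear hom (sval N) (sval M1) -> (Ext1 (sval N) X : lmodType k)} :=
  HB.pack f (GRing.isLinear.Build k _ _ _ f f_lin).
by apply: (finite_dim_surj (f := g)) (hom_fin _ _).
Qed.

Definition H_ob : cofunctor stable_cat :=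
  @Cofunctor k stable_cat (fun N => Ext1 (sval N) X) H_fin H_map
    (fun _ _ _ => Ext1_pull_linear _) H_id H_comp H_add.

Lemma H_ob_fp : finitely_presented H_ob.
Proof.
have [M0 [M1 [p [w wP]]]] := ML_presentation.
pose pbar : hom M0 M1 := lmod_quot_pi _ p.
have phi_nat (N N' : stable_cat) (f : hom N N') (v : hom N' M0) :
  pbar ∘ (v ∘ f) = pbar ∘ v ∘ f by rewrite compA.
have phi_lin N : linear (fun v : hom N M0 => pbar ∘ v) by apply: comp_linr.
pose eps (N : stable_cat) (v : hom N M1) : H_ob N := Ext1_pull (lmod_quot_repr v) w.
have epsE (N : stable_cat) (c : hom (sval N) (sval M1)) :
  eps N (lmod_quot_pi _ c) = Ext1_pull c w by apply: stable_pull.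
have eps_lin N : linear (eps N).
  move=> a u v; rewrite -(lmod_quot_reprK u) -(lmod_quot_reprK v) -linearP.
  rewrite !epsE Ext1_pullD; congr (_ + _).
  have [xi ->] := ext_clP w.
  have /(ext_mor_scale a)/Ext1_morP := ext_pullbackP (lmod_quot_repr u) xi.
  by rewrite -Ext1_pull_cl => <-.
have eps_nat (N N' : stable_cat) (f : hom N N') (v : hom N' M1) :
    eps N (v ∘ f) = cf_map H_ob f (eps N' v).
  by rewrite epsE Ext1_pullM.
exists M0, M1, (@NatTrans _ _ (representable M0) (representable M1) _ phi_lin phi_nat).
exists (@NatTrans _ _ (representable M1) H_ob eps eps_lin eps_nat) => N /=.
split=> [v|a].
  rewrite (wP N).1; split=> [[g vE]|[u <-]].
    exists (lmod_quot_pi _ g : hom N M0).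
    rewrite -[RHS]lmod_quot_reprK vE.
    exact: (@quot_compE k _ (full_ideal M
      (factor_ideal (ex_additive B) (projectives B))) N M0 M1 p g).
  rewrite -(wP N).1 -/(eps N _) eps_nat -[pbar]/(lmod_quot_pi _ p) epsE.
  have -> : Ext1_pull p w = 0.
    by apply/(wP M0).1; exists (idl _); rewrite comp1r.
  exact: Ext1_pull_0.
by have [c <-] := (wP N).2 a; exists (lmod_quot_pi _ c); apply: epsE.
Qed.

Definition H_modfp : modfp stable_cat := exist _ H_ob H_ob_fp.

End OnObjects.

Section OnMorphisms.
Variables (X Y : ML_cat) (f : hom X Y).

Fact H_natural (N N' : stable_cat) (c : hom N N') (u : Ext1 (sval N') (sval X)) :
  Ext1_push f (H_map c u) = H_map c (Ext1_push f u).
Proof. exact: Ext1_push_pull. Qed.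

Definition H_arr : arr (H_modfp (svalP X)) (H_modfp (svalP Y)) :=
  @NatTrans _ _ (H_ob (svalP X)) (H_ob (svalP Y))
    (fun N => Ext1_push f) (fun N => Ext1_push_linear f) H_natural.

End OnMorphisms.

Fact H_fmap1 (X : ML_cat) : H_arr (idl X) = idc (H_modfp (svalP X)).
Proof. by apply: nat_trans_eq => N u; apply: Ext1_push1. Qed.
Fact H_fmapM (X Y Z : ML_cat) (g : hom Y Z) (f : hom X Y) :
  H_arr (g ∘ f) = cmp (H_arr g) (H_arr f).
Proof. by apply: nat_trans_eq => N u; apply: Ext1_pushM. Qed.

Definition functor_H : functor ML_cat (modfp stable_cat) :=
  @Functor ML_cat (modfp stable_cat) (fun X => H_modfp (svalP X)) H_arr
    H_fmap1 H_fmapM.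

Fact H_vanishes (X Y : ML_cat) (f g : hom X Y) :
  f - g \in full_ideal ML (factor_ideal (ex_additive B) M) X Y ->
  fmap functor_H f = fmap functor_H g.
Proof.
move=> /asboolP[Z ZM [b [a e]]]; apply: nat_trans_eq => N u /=.
apply/eqP; rewrite -subr_eq0 -Ext1_pushB e Ext1_pushM; apply/eqP.
rewrite (Mrigid (svalP N) ZM (Ext1_push a u)); exact: Ext1_push_0.
Qed.

Definition functor_F : functor ML_quot (modfp stable_cat) := quot_functor H_vanishes.

End TheFunctor.

(* Main.v *)
(* For 0 -> X -> M0 -> M1 -> 0 with M0, M1 in M, rigidity makes every class in
   Ext1(N, X), N in M, a pullback c^* w of its class w in Ext1(M1, X).
   Faithful: if f_* w = 0 then f extends along X -> M0.
   Full: t : HX -> HY is determined by t w; since w, hence t w, dies on M0, the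
   map M0 -> M1 lifts to the middle term of t w, and the induced map on kernels
   a : X -> Y satisfies a_* w = t w.
   Essentially surjective: if p : d1 -> d0 presents A and q : P -> d0 is a
   deflation with P projective, then (p q) : d1 + P -> d0 is a deflation; with X
   its kernel, HX and A are quotients of the stable Hom(-, d0) by the same
   subfunctor. *)
Require Import Defs.
From mathcomp Require Import all_boot all_algebra.
From mathcomp Require Import boolp.

Set Implicit Arguments.
Unset Strict Implicit.
Unset Printing Implicit Defensive.

Import GRing.Theory Defs.
Local Open Scope ring_scope.

Section FullyFaithful.
Variables (C D : category) (F : functor C D).

(** The quasi-inverse picks for each [d] an object [s d] with an isomorphism [e d], and lifts the
    conjugates of arrows by these; faithfulness reduces every law to an equation in [D]. *)
Lemma equivalence_of_fully_faithful :
  (forall x y (f g : arr x y), fmap F f = fmap F g -> f = g) ->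
  (forall x y (g : arr (F x) (F y)), exists f, fmap F f = g) ->
  (forall d : D, exists x (e : arr (F x) d), is_iso_arr e) ->
  equivalence_of_categories F.
Proof.
move=> faith full esurj.
have /choice[s sP] := esurj.
have eP d : {e : arr (F (s d)) d | is_iso_arr e} by exact/cid/sP.
pose e d := sval (eP d).
have e'P d : {e' : arr d (F (s d)) |
    cmp e' (e d) = idc _ /\ cmp (e d) e' = idc _}.
  exact/cid/(svalP (eP d)).
pose e' d := sval (e'P d).
have e'e d : cmp (e' d) (e d) = idc _ := (svalP (e'P d)).1.
have ee' d : cmp (e d) (e' d) = idc _ := (svalP (e'P d)).2.
pose lift x y g := sval (cid (full x y g)).
have liftE x y g : fmap F (lift x y g) = g := svalP (cid (full x y g)).
pose Gmap d d' (g : arr d d') := lift _ _ (cmp (e' d') (cmp g (e d))).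
have G1 d : Gmap _ _ (idc d) = idc _.
  by apply: faith; rewrite liftE cmp1l e'e fmap1.
have GM d d' d'' (g : arr d' d'') (f : arr d d') :
    Gmap _ _ (cmp g f) = cmp (Gmap _ _ g) (Gmap _ _ f).
  apply: faith; rewrite fmapM !liftE -!cmpA; congr cmp; congr cmp.
  by rewrite (cmpA (e d')) ee' cmp1l.
exists (@Functor D C s Gmap G1 GM); split.
- exists (fun x => lift _ _ (e (F x))); split=> [x y f|x] /=.
    by apply: faith; rewrite !fmapM !liftE cmpA ee' cmp1l.
  exists (lift _ _ (e' (F x))).
  by split; apply: faith; rewrite fmapM !liftE fmap1.
exists e; split=> [d d' g|d] /=; first by rewrite liftE cmpA ee' cmp1l.
by exists (e' d).
Qed.

End FullyFaithful.

Section Cofunctors.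
Variables (k : fieldType) (D : linCat k).
Implicit Types A R : cofunctor D.

Definition epi_nat R A (t : nat_trans R A) : Prop :=
  forall x a, exists v, t x v = a.

Lemma nat_transB A A' (t : nat_trans A A') x (v w : A x) :
  t x (v - w) = t x v - t x w.
Proof. by rewrite -!scaleN1r addrC nt_linear addrC. Qed.

(** The chosen preimages [s x a] need be neither linear nor natural; applying [e'] removes the
    choice, since [e'] is constant on each fibre of [e]. *)
Lemma epi_nat_factor R A A' (e : nat_trans R A) (e' : nat_trans R A') :
  epi_nat e -> (forall x v, e x v = 0 -> e' x v = 0) ->
  exists t : nat_trans A A', forall x v, t x (e x v) = e' x v.
Proof.
move=> e_epi ker; pose s x a := sval (cid (e_epi x a)).
have sE x a : e x (s x a) = a := svalP (cid (e_epi x a)).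
have e'E x v w : e x v = e x w -> e' x v = e' x w.
  move=> /eqP; rewrite -subr_eq0 -nat_transB => /eqP/ker/eqP.
  by rewrite nat_transB subr_eq0 => /eqP.
have t_lin x : linear (fun a => e' x (s x a)).
  by move=> c a b; rewrite -nt_linear; apply: e'E; rewrite nt_linear !sE.
have t_nat x y (f : hom x y) a :
    e' x (s x (cf_map A f a)) = cf_map A' f (e' y (s y a)).
  by rewrite -nt_natural; apply: e'E; rewrite nt_natural !sE.
by exists (NatTrans t_lin t_nat) => x v /=; apply: e'E; rewrite sE.
Qed.

Lemma epi_nat_iso R A A' (e : nat_trans R A) (e' : nat_trans R A') :
  epi_nat e -> epi_nat e' -> (forall x v, e x v = 0 <-> e' x v = 0) ->
  exists t : arr (A : Mod D) A', is_iso_arr t.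
Proof.
move=> e_epi e'_epi ker.
have [t tE] := epi_nat_factor e_epi (fun x v => (ker x v).1).
have [s sE] := epi_nat_factor e'_epi (fun x v => (ker x v).2).
exists t, s; split; apply: nat_trans_eq => x a /=.
  by have [v <-] := e_epi x a; rewrite tE sE.
by have [v <-] := e'_epi x a; rewrite sE tE.
Qed.

(** Yoneda: this turns a presentation into composition with a single morphism. *)
Lemma nat_repE d A (t : nat_trans (representable d) A) x (v : hom x d) :
  t x v = cf_map A v (t d (idl d)).
Proof. by rewrite -nt_natural /= comp1l. Qed.

End Cofunctors.

Section ExactCat.
Variables (k : fieldType) (B : exactCat k).
Implicit Types X Y Z M N P : B.

Lemma subcat_biprod (M : subcat B) X Y (b : biprod X Y) : M X -> M Y -> M b.
Proof.
(* Indexing through a boolean lets one case analysis reduce objects and maps together. *)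
move=> MX MY; pose S (j : bool) := if j then Y else X.
pose Z (j : 'I_2) := S (j == 1 :> nat).
pose i (j : 'I_2) : hom (Z j) b :=
  if (j == 1 :> nat) as c return hom (S c) b then inj2 b else inj1 b.
pose p (j : 'I_2) : hom b (Z j) :=
  if (j == 1 :> nat) as c return hom b (S c) then prj2 b else prj1 b.
apply: (@subcat_dsum _ _ M _ Z); last by rewrite /Z => j; case: (_ == _).
exists i, p; split.
- by rewrite /i /p /Z => j; case: (_ == _); rewrite ?prj1inj1 ?prj2inj2.
- case=> [[|[|j]] hj] // [[|[|l]] hl] //= _; rewrite /i /p /Z /=.
    exact: prj1inj2.
  exact: prj2inj1.
- by rewrite !big_ord_recl big_ord0 addr0 -[RHS]biprod_sum.
Qed.

(** The copairing [[f, q]] is [[f, 1]] after [1 ⊕ q], and deflations compose. *)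
Lemma deflation_copair X Y Z (b : biprod X Y) (f : hom X Z) (q : hom Y Z) :
  deflation q -> deflation (f ∘ prj1 b + q ∘ prj2 b).
Proof.
move=> [K [i iq]]; have [L [j jX]] := deflation_id X.
pose b' := biprod_of X Z.
have d1 : deflation (biprod_map b b' (idl X) q).
  by exists (biprod_of L K); eexists; apply: (ses_sum (biprod_of L K)) jX iq.
(* [f, 1] is the projection composed with a shear of X + Z. *)
have d2 : deflation (f ∘ prj1 b' + prj2 b').
  exists X, (inj1 b' - inj2 b' ∘ f).
  pose sh : hom b' b' := idl _ - inj2 b' ∘ f ∘ prj1 b'.
  apply: (ses_iso (a := idl X) (b := sh) (c := idl Z) _ _ _ _ _ (ses_split b'));
    try exact: iso_id.
  (* The off-diagonal term squares to zero, so changing its sign inverts the shear. *)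
  - exists (idl _ + inj2 b' ∘ f ∘ prj1 b').
    have n : inj2 b' ∘ f ∘ prj1 b' ∘ (inj2 b' ∘ f ∘ prj1 b') = 0.
      by rewrite -!compA (compA (prj1 b')) prj1inj2 comp0l !comp0r.
    by split; rewrite /sh !(compBl, compDl, compBr, compDr) n
      !(comp1l, comp1r) ?(addr0, subr0) ?(addrK, subrK).
  - by rewrite comp1r /sh compBl comp1l -!compA prj1inj1 comp1r.
  - rewrite comp1l /sh compBr compDl !compDl comp1r -!compA.
    rewrite !(compA (prj1 b')) prj1inj2 !(compA (prj2 b')) prj2inj2.
    by rewrite !(comp0l, comp1l, comp0r) add0r addrC addKr comp1r.
have := deflation_comp d1 d2.
by rewrite compDl -compA prj1_map prj2_map comp1l.
Qed.

(** Scalars on [Ext1] act by pushout; scaling a whole morphism of extensions carries them over to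
    the pullback side. *)
Lemma Ext1_pullZ N N' X a (c : hom N N') (w : Ext1 N' X) :
  Ext1_pull (a *: c) w = a *: Ext1_pull c w.
Proof.
have [xi ->] := ext_clP w.
have /(ext_mor_scale a)/Ext1_morP := ext_pullbackP c xi.
by rewrite -Ext1_pull_cl => <-.
Qed.

End ExactCat.

Section TheFunctor.
Variables (k : fieldType) (B : exactCat k) (M : subcat B).
Hypothesis Mrigid : rigid M.

Local Notation stM := (stable_cat M).
Local Notation cl := (@lmod_quot_pi _ _ _).
Local Notation rep := (@lmod_quot_repr _ _ _).

Lemma functor_F_faithful (X Y : (ML_quot M : category)) (f g : arr X Y) :
  fmap (functor_F Mrigid) f = fmap (functor_F Mrigid) g -> f = g.
Proof.
move=> e; rewrite -(lmod_quot_reprK f) -(lmod_quot_reprK g).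
apply/lmod_quot_eq/asboolP; case: (svalP X) => M0 [M1 [i [p [M0M M1M ip]]]].
(* Evaluate at the class of the chosen sequence: the difference of representatives kills it, hence
   extends along [i]. *)
have /eqP := congr1 (fun t : nat_trans (H_ob Mrigid (svalP X)) (H_ob Mrigid (svalP Y)) =>
  t (exist _ M1 M1M : stM) (ext_cl (Extension ip))) e.
rewrite -subr_eq0 /= -Ext1_pushB => /eqP/Ext1_push_eq0[h hE].
by exists M0 => //; exists h, i.
Qed.

Lemma functor_F_full (X Y : (ML_quot M : category))
    (t : arr (functor_F Mrigid X) (functor_F Mrigid Y)) :
  exists f : arr X Y, fmap (functor_F Mrigid) f = t.
Proof.
pose T : nat_trans (H_ob Mrigid (svalP X)) (H_ob Mrigid (svalP Y)) := t.
have [M0 [M1 [i [p [M0M M1M ip]]]]] := svalP X.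
pose N0 : stM := exist _ M0 M0M; pose N1 : stM := exist _ M1 M1M.
pose w : Ext1 M1 (sval X) := ext_cl (Extension ip).
have tE (N : stM) (c : hom (sval N) M1) :
    T N (Ext1_pull c w) = Ext1_pull c (T N1 w).
  have := nt_natural T (cl c : hom N N1) w.
  by rewrite /= /H_map !stable_pull.
have [eta etaE] := ext_clP (T N1 w : Ext1 M1 (sval Y)).
have /Ext1_pull_eq0[g gE] : Ext1_pull p (ext_cl eta) = 0.
  rewrite -etaE -(tE N0).
  have -> : Ext1_pull p w = 0.
    by apply/Ext1_pull_eq0; exists (idl _); rewrite comp1r.
  by rewrite -[X in T _ X](subrr (0 : Ext1 M0 (sval X))) nat_transB subrr.
have [|a [aE _]] := (ses_kernel (extensionP eta)).2 _ (g ∘ i).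
  by rewrite compA -gE (ses_kernel ip).1.
(* [g] is a morphism of extensions over [a] and the identity of [M1]. *)
have aw : Ext1_push a w = T N1 w.
  rewrite etaE -[RHS]Ext1_pull1; apply/Ext1_morP.
  by exists g; rewrite comp1l /= aE -gE.
exists (cl a); rewrite [LHS](quot_fmapE (H_vanishes Mrigid)).
apply: nat_trans_eq => N u /=; have [xi ->] := ext_clP u.
(* Rigidity lets [i] extend to [h] on the middle term of [xi]; the map [c] induced on cokernels
   exhibits [u] as [c^* w]. *)
have /Ext1_push_eq0[h hi] : Ext1_push i (ext_cl xi) = 0.
  exact: (Mrigid (svalP N) M0M).
have [|c [cE _]] := (ses_cokernel (extensionP xi)).2 _ (p ∘ h).
  by rewrite -compA -hi (ses_kernel ip).1.
have -> : ext_cl xi = Ext1_pull c w.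
  rewrite -[LHS]Ext1_push1; apply/Ext1_morP.
  by exists h; rewrite /= comp1r.
by rewrite tE Ext1_push_pull aw.
Qed.

Hypothesis B_projectives : enough_projectives B.
Hypothesis M_projectives : forall P : B, projective P -> M P.

Lemma functor_F_ess_surj (A : modfp stM) :
  exists (X : (ML_quot M : category)) (t : arr (functor_F Mrigid X) A), is_iso_arr t.
Proof.
case: A => A Afp; have [d1 [d0 [phi [eps epsP]]]] := Afp.
(* The Yoneda element of [phi], lifted from the stable Hom to a morphism of [B]. *)
pose p : hom (sval d1) (sval d0) := rep (phi d1 (idl d1)).
have [P [q [pP q_def]]] := B_projectives (sval d0).
pose b := biprod_of (sval d1) P.
have Mb : M b by apply: subcat_biprod (svalP d1) (M_projectives pP).
have [X [i ses_i]] := deflation_copair b p q_def.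
have X_ML : ML M X.
  by exists b, (sval d0), i, (p ∘ prj1 b + q ∘ prj2 b); split=> //; apply: svalP.
pose xi := Extension ses_i; pose w : Ext1 (sval d0) X := ext_cl xi.
pose HX := functor_F Mrigid (exist _ X X_ML : ML_quot M).
(* The connecting map from [Hom(-, d0)] to [Ext1(-, X)], on stable classes. *)
pose e (N : stM) (v : hom N d0) : (sval HX) N := Ext1_pull (rep v) w.
have eE (N : stM) (c : hom (sval N) (sval d0)) : e N (cl c) = Ext1_pull c w.
  exact: stable_pull.
have e_lin N : linear (e N).
  move=> a u v; rewrite -(lmod_quot_reprK u) -(lmod_quot_reprK v) -linearP.
  by rewrite !eE Ext1_pullD Ext1_pullZ.
have e_nat (N N' : stM) (f : hom N N') (v : hom N' d0) :
    e N (v ∘ f) = cf_map (sval HX) f (e N' v).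
  by rewrite eE Ext1_pullM.
pose E := @NatTrans _ _ (representable d0) (sval HX) e e_lin e_nat.
exists (exist _ X X_ML).
apply: (@epi_nat_iso _ _ (representable d0) (sval HX) A E eps).
- move=> N u; have [eta ->] := ext_clP (u : Ext1 (sval N) X).
  have /Ext1_push_eq0[h hi] : Ext1_push i (ext_cl eta) = 0.
    exact: (Mrigid (svalP N) Mb).
  have [|c [cE _]] := (ses_cokernel (extensionP eta)).2 _ (prj xi ∘ h).
    by rewrite -compA -hi (ses_kernel ses_i).1.
  exists (cl c); rewrite /= eE -[RHS]Ext1_push1; symmetry; apply/Ext1_morP.
  by exists h; rewrite /= comp1r.
- by move=> N a; have [v <-] := (epsP N).2 a; exists v.
(* Kernels are compared: factoring through [(p q)] in [B] against factoring through [p] stably. *)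
move=> N v; rewrite (epsP N).1 /= /e Ext1_pull_eq0 /=.
have phiE (g : hom (sval N) (sval d1)) : phi N (cl g) = cl (p ∘ g).
  rewrite nat_repE /= -[phi d1 _]lmod_quot_reprK.
  exact: (@quot_compE k _ (full_ideal M
    (factor_ideal (ex_additive B) (projectives B))) N d1 d0 p g).
split=> [[g vE]|[u <-]].
  (* The summand involving [q] passes through the projective [P], so it is stably zero. *)
  exists (cl (prj1 b ∘ g)); rewrite phiE -[RHS]lmod_quot_reprK vE.
  apply/lmod_quot_eq/asboolP; exists P => //.
  exists (- q), (prj2 b ∘ g).
  by rewrite compDl -!compA opprD addrA subrr add0r compNl.
rewrite -(lmod_quot_reprK u) phiE.
(* The chosen representative differs from [p ∘ rep u] by a map through a projective [P']; its leg
   into [d0] lifts along the deflation [q], which supplies the [P] component. *)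
have /asboolP[P' pP' [c [a cE]]] := lmod_quot_reprB (full_ideal M
  (factor_ideal (ex_additive B) (projectives B)) N d0) (p ∘ rep u).
have [l lE] := pP' _ _ q c q_def.
exists (inj1 b ∘ rep u + inj2 b ∘ (l ∘ a)).
rewrite compDl !compDr -!compA !(compA (prj1 b)) !(compA (prj2 b)).
rewrite prj1inj1 prj1inj2 prj2inj1 prj2inj2 !(comp0l, comp0r, comp1l).
by rewrite addr0 add0r (compA q) -lE -cE addrC subrK.
Qed.

End TheFunctor.

Theorem theorem3p2 (k : fieldType) (B : exactCat k)
    (B_krull_schmidt : krull_schmidt B)
    (B_projectives : enough_projectives B)
    (B_injectives : enough_injectives B)
    (M : subcat B)
    (M_rigid : rigid M)
    (M_projectives : forall P : B, projective P -> M P) :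
  equivalence_of_categories (functor_F M_rigid).
Proof.
apply: equivalence_of_fully_faithful.
- exact: functor_F_faithful.
- exact: functor_F_full.
- exact: functor_F_ess_surj.
Qed.
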